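(* Let $p\in(1,\infty)$ and let $q\in L_1^{\mathrm{loc}}(\mathbb R)$ with $q\ge 0$. Suppose that the equation $-y''(x)+q(x)y(x)=f(x)$, $x\in\mathbb R$, is correctly solvable in $L_p(\mathbb R)$. Then the spaces $S_p^{(2)}(\mathbb R,q)$ and $W_p^{(2)}(\mathbb R,q)$ are isomorphic (i.e. they coincide as sets and have equivalent norms) if and only if the equation $-y''+qy=f$ is separable in $L_p(\mathbb R)$.
   Context: $\|\cdot\|_p$ is the norm of $L_p(\mathbb R)$. $AC_{\mathrm{loc}}^{(1)}(\mathbb R)$ is the set of functions that are absolutely continuous together with their (first) derivatives on every finite interval of $\mathbb R$. Spaces: $S_p^{(2)}(\mathbb R,q)=\{y\in AC_{\mathrm{loc}}^{(1)}(\mathbb R):\ \|y''-qy\|_p+\|q^{1/p}y\|_p<\infty\}$ with norm $\|y''-qy\|_p+\|q^{1/p}y\|_p$, and $W_p^{(2)}(\mathbb R,q)=\{y\in AC_{\mathrm{loc}}^{(1)}(\mathbb R):\ \|y''\|_p+\|qy\|_p<\infty\}$ with norm $\|y''\|_p+\|qy\|_p$. Isomorphic: normed vector spaces $B_1$, $B_2$ are called isomorphic here if they coincide set-theoretically and have equivalent norms. Solution: a solution of $-y''+qy=f$ is any $y\in AC_{\mathrm{loc}}^{(1)}(\mathbb R)$ satisfying the equation almost everywhere on $\mathbb R$. Correct solvability: the equation $-y''+qy=f$ is correctly solvable in $L_p(\mathbb R)$ if (I) for every $f\in L_p(\mathbb R)$ there is a unique solution $y\in L_p(\mathbb R)$;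 and (II) there is a constant $c(p)\in(0,\infty)$, independent of $f$, such that for every $f\in L_p(\mathbb R)$ the solution $y\in L_p(\mathbb R)$ satisfies $\|y\|_p\le c(p)\|f\|_p$. Separability: a correctly solvable in $L_p(\mathbb R)$ equation $-y''+qy=f$ is separable in $L_p(\mathbb R)$ if there is a constant $c(p)\in(0,\infty)$, independent of $f$, such that for every $f\in L_p(\mathbb R)$ the solution $y\in L_p(\mathbb R)$ satisfies $\|y''\|_p+\|qy\|_p\le c(p)\|f\|_p$. *)

(* Defs.v *)
From HB Require Import structures.
From mathcomp Require Import all_boot all_order all_algebra.
From mathcomp Require Import all_classical all_reals all_analysis.

Set Implicit Arguments.
Unset Strict Implicit.
Unset Printing Implicit Defensive.

Import Order.TTheory GRing.Theory Num.Theory.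
Import numFieldNormedType.Exports.

Local Open Scope classical_set_scope.
Local Open Scope ring_scope.

Section SturmLiouville.
Context {R : realType}.
Implicit Types (p : R) (q f y : R -> R).

Definition Lp_norm p f : \bar R :=
  Lnorm (@lebesgue_measure R) p%:E (EFin \o f).

(* Membership asks for Borel measurability; every Lebesgue class in L_p has such
   a representative, and all notions below are invariant under almost everywhere
   modification of q and f. *)
Definition in_Lp p f : Prop := f \in Lfun (@lebesgue_measure R) p%:E.

(* Degenerate subintervals (u i = v i) are harmless: they contribute 0 to
   both sums. *)
Definition abs_continuous (a b : R) f : Prop :=
  forall e : R, 0 < e -> exists2 d : R, 0 < d &
    forall (n : nat) (u v : 'I_n -> R),
      (forall i, [/\ a <= u i, u i <= v i & v i <= b]) ->
      trivIset [set: 'I_n] (fun i => `]u i, v i[%classic) ->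
      \sum_(i < n) (v i - u i) < d ->
      \sum_(i < n) `|f (v i) - f (u i)| < e.

Definition AC1_loc y : Prop :=
  (forall x, derivable y x 1) /\
  (forall a b : R, abs_continuous a b y /\ abs_continuous a b (derive1 y)).

(* For y in AC1_loc, derive1n 2 y is the second derivative almost everywhere;
   where derive1 y is not differentiable it takes a default value, on a null set
   that affects neither the norms nor the almost everywhere equation below. *)
Definition S_norm p q y : \bar R :=
  (Lp_norm p (fun x => (derive1n 2 y x - q x * y x)%R)
   + Lp_norm p (fun x => (q x `^ p^-1 * y x)%R))%E.

Definition S_space p q : set (R -> R) :=
  [set y | AC1_loc y /\ (S_norm p q y < +oo)%E].

Definition W_norm p q y : \bar R :=
  (Lp_norm p (derive1n 2 y) + Lp_norm p (fun x => (q x * y x)%R))%E.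

Definition W_space p q : set (R -> R) :=
  [set y | AC1_loc y /\ (W_norm p q y < +oo)%E].

Definition isomorphic (B1 : set (R -> R)) (N1 : (R -> R) -> \bar R)
    (B2 : set (R -> R)) (N2 : (R -> R) -> \bar R) : Prop :=
  B1 = B2 /\
  exists c1 c2 : R, [/\ 0 < c1, 0 < c2 &
    forall y, B1 y -> (c1%:E * N1 y <= N2 y)%E /\ (N2 y <= c2%:E * N1 y)%E].

Definition solution q f y : Prop :=
  AC1_loc y /\
  {ae @lebesgue_measure R, forall x, - derive1n 2 y x + q x * y x = f x}.

Definition correctly_solvable p q : Prop :=
  (forall f, in_Lp p f -> exists! y, solution q f y /\ in_Lp p y) /\
  (exists2 c : R, 0 < c & forall f y, in_Lp p f -> solution q f y ->
     in_Lp p y -> (Lp_norm p y <= c%:E * Lp_norm p f)%E).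

Definition separable p q : Prop :=
  correctly_solvable p q /\
  (exists2 c : R, 0 < c & forall f y, in_Lp p f -> solution q f y ->
     in_Lp p y ->
     (Lp_norm p (derive1n 2 y) + Lp_norm p (fun x => (q x * y x)%R)
       <= c%:E * Lp_norm p f)%E).

End SturmLiouville.

(* Main.v *)
(* Testing -y'' + qy = f against |y|^(p-2) y bounds the integral of q |y|^p by those of |f|^p and
   |y|^p. Hence, by correct solvability, |q^(1/p) y|_p <= K |f|_p for the L_p solution y, and on
   L_p solutions the norm of S is equivalent to |f|_p; separability is the same statement for the
   norm of W. It remains to see that every y in S or in W is the L_p solution for
   f = -y'' + qy. The difference z of the two satisfies z'' = qz, and q^(1/p) z (for S) or qz
   (for W) is in L_p, so that z' is bounded, respectively O(r^(1 - 1/p)) on [-2r, 2r]. For a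
   cutoff phi at scale r, the function z phi then solves the equation with a right-hand side
   bounded in L_p uniformly in r; condition (II) puts z in L_p, and (I) gives z = 0.

   The fundamental theorem of calculus for absolutely continuous functions comes from splitting
   off the total variation: a nondecreasing absolutely continuous function has a
   Lebesgue-Stieltjes measure dominated by the Lebesgue measure, whose Radon-Nikodym density is
   its derivative almost everywhere by Lebesgue differentiation. *)

Require Import Defs.
From HB Require Import structures.
From mathcomp Require Import all_boot all_order all_algebra.
From mathcomp Require Import all_classical all_reals all_analysis measurable_realfun.
From mathcomp Require Import ring lra.
Import Order.TTheory GRing.Theory Num.Theory.
Import numFieldNormedType.Exports HBNNSimple.
Local Open Scope classical_set_scope.
Local Open Scope ring_scope.

Set Implicit Arguments.
Unset Strict Implicit.
Unset Printing Implicit Defensive.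

(** * Absolutely continuous functions *)

Section AbsolutelyContinuous.
Context {R : realType}.
Implicit Types (a b c d e : R) (f g : R -> R).

(** Membership in S or W does not include y in L_p, whereas (I) gives uniqueness only inside L_p;
    and since q may vanish on large sets, q^(1/p) z or qz in L_p says nothing directly about the
    size of z. The exponent 1 - 1/p is critical for the cutoff argument: z' = O(r^(1-1/p)) gives z =
    O(r^(2-1/p)), and with phi' = O(1/r), phi'' = O(1/r^2) the right-hand side -2z'phi' - z phi'' is
    O(r^(-1/p)) on an interval of length 4r, so its L_p norm stays bounded.

    The test function |y|^(p-2) y meets two obstacles. It is not differentiable at zeros of y when p
    < 2, hence a regularisation by a parameter e; and boundary terms would contain y', on which
    there is no a priori bound, hence a cutoff onto which both derivatives are moved. The parameter
    e goes to 0 before r grows, because q is integrable only locally.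

    The identification with L_p solutions serves the passage from separability to isomorphism. In
    the W case separability itself puts q y0 in L_p for the L_p solution y0 with which y is
    compared. *)

Lemma abs_continuousS a b c d f : a <= c -> d <= b ->
  abs_continuous a b f -> abs_continuous c d f.
Proof.
move=> ac db acf e e0; have [r r0 H] := acf e e0; exists r => // n u v uv tuv.
by apply: H => // i; have [cu ? vd] := uv i; split => //;
  [exact: le_trans cu|exact: le_trans vd db].
Qed.

Lemma abs_continuousD a b f g :
  abs_continuous a b f -> abs_continuous a b g -> abs_continuous a b (f \+ g).
Proof.
move=> acf acg e e0; have e20 : 0 < e / 2 by rewrite divr_gt0.
have [r r0 Hf] := acf _ e20; have [s s0 Hg] := acg _ e20.
exists (Num.min r s); first by rewrite lt_min r0.
move=> n u v uv tuv; rewrite lt_min => /andP[uvr uvs].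
rewrite [e]splitr; apply: le_lt_trans (ltrD (Hf n u v _ _ _) (Hg n u v _ _ _)) => //.
rewrite -big_split/=; apply: ler_sum => i _.
by rewrite opprD addrACA ler_normD.
Qed.

Lemma abs_continuous_lip a b f M :
  (forall x y, a <= x -> x <= y -> y <= b -> `|f y - f x| <= M * (y - x)) ->
  abs_continuous a b f.
Proof.
move=> lipf e e0; exists (e / (`|M| + 1)); first by rewrite divr_gt0// ltr_wpDl.
move=> n u v uv _; rewrite ltr_pdivlMr ?ltr_wpDl// => H.
apply: le_lt_trans H; rewrite mulr_suml; apply: ler_sum => i _.
have [au uv' vb] := uv i.
apply: le_trans (lipf _ _ au uv' vb) _; rewrite mulrC ler_wpM2l ?subr_ge0//.
by rewrite (le_trans (ler_norm _))// lerDl.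
Qed.

Lemma abs_continuous_modulus a b f : abs_continuous a b f ->
  forall e, 0 < e -> exists2 d, 0 < d &
    forall x y, a <= x -> x <= y -> y <= b -> y - x < d -> `|f y - f x| < e.
Proof.
move=> acf e e0; have [r r0 H] := acf e e0; exists r => // x y ax xy yb xyr.
have := H 1%N (fun=> x) (fun=> y); rewrite !big_ord_recl !big_ord0 !addr0.
apply => //; move=> i j _ _ _; by rewrite [i]ord1 [j]ord1.
Qed.

(** Over a length below the modulus for e = 1 the function changes by less than 1; finitely many
    steps of length r / 2 cover the segment, half of r because the modulus asks for a strict
    inequality. *)
Lemma abs_continuous_bounded a b f : abs_continuous a b f ->
  exists M : R, forall x, a <= x -> x <= b -> `|f x| <= M.
Proof.
move=> acf; have [r r0 H] := abs_continuous_modulus acf (ltr01).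
have [ba|ab] := ltP b a.
  by exists 0 => x ax xb; move: (le_lt_trans (le_trans ax xb) ba); rewrite ltxx.
have step (n : nat) : forall x, a <= x -> x <= b -> x <= a + n%:R * (r / 2) ->
    `|f x| <= `|f a| + n%:R.
  elim: n => [|n ih] x ax xb; first by rewrite mul0r !addr0 => xa;
    have -> : x = a by [apply/eqP; rewrite eq_le xa].
  move=> xn; have [xr|rx] := leP x (a + n%:R * (r / 2)).
    by rewrite (le_trans (ih _ ax xb xr))// lerD2l ler_nat.
  set y := a + n%:R * (r / 2) in rx.
  have ay : a <= y by rewrite lerDl mulr_ge0// divr_ge0// ltW.
  have yb : y <= b by rewrite (le_trans (ltW rx)).
  have := H y x ay (ltW rx) xb.
  have -> : x - y < r.
    have : x - y <= r / 2.
      move: xn; rewrite /y -natr1 mulrDl mul1r; lra.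
    by move=> /le_lt_trans; apply; rewrite ltr_pdivrMr// ltr_pMr// ltr1n.
  move=> /(_ isT) fxy; have := ih y ay yb (lexx _).
  rewrite -natr1 addrA => fy.
  have -> : f x = f y + (f x - f y) by ring.
  by rewrite (le_trans (ler_normD _ _))// lerD// ltW.
have [n hn] : exists n : nat, b <= a + n%:R * (r / 2).
  exists (Num.truncn ((b - a) / (r / 2))).+1.
  rewrite -lerBlDl -ler_pdivrMr ?divr_gt0// ltW//.
  by rewrite truncnS_gt.
by exists (`|f a| + n%:R) => x ax xb; apply: step => //; exact: le_trans hn.
Qed.

Lemma abs_continuousM a b f g :
  abs_continuous a b f -> abs_continuous a b g ->
  abs_continuous a b (fun x => f x * g x).
Proof.
move=> acf acg.
have [M Mf] := abs_continuous_bounded acf.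
have [N Ng] := abs_continuous_bounded acg.
move=> e e0.
have M1 : 0 < `|M| + 1 by rewrite ltr_wpDl.
have N1 : 0 < `|N| + 1 by rewrite ltr_wpDl.
have e10 : 0 < e / 2 / (`|M| + 1) by rewrite !divr_gt0.
have e20 : 0 < e / 2 / (`|N| + 1) by rewrite !divr_gt0.
have [r r0 Hf] := acf _ e20; have [s s0 Hg] := acg _ e10.
exists (Num.min r s); first by rewrite lt_min r0.
move=> n u v uv tuv; rewrite lt_min => /andP[uvr uvs].
have := Hf n u v uv tuv uvr; have := Hg n u v uv tuv uvs.
rewrite (ltr_pdivlMr _ _ M1) (ltr_pdivlMr _ _ N1) => G F.
rewrite [e]splitr; apply: le_lt_trans (ltrD F G).
rewrite !mulr_suml -big_split/=; apply: ler_sum => i _.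
have [au uv' vb] := uv i; have ub := le_trans uv' vb; have av := le_trans au uv'.
have -> : f (v i) * g (v i) - f (u i) * g (u i) =
  (f (v i) - f (u i)) * g (v i) + (g (v i) - g (u i)) * f (u i) by ring.
rewrite (le_trans (ler_normD _ _))// !normrM lerD// ler_wpM2l//.
  by rewrite (le_trans (Ng _ av vb))// (le_trans (ler_norm _))// lerDl.
by rewrite (le_trans (Mf _ au ub))// (le_trans (ler_norm _))// lerDl.
Qed.

(* For nondegenerate intervals, given by their end points, this is disjointness of the interiors;
   unlike disjointness, it also constrains degenerate intervals and so survives refinement. *)
Definition sep (x y : R * R) : bool := Num.min x.2 y.2 <= Num.max x.1 y.1.

Definition in_segment a b (x : R * R) : bool := [&& a <= x.1, x.1 <= x.2 & x.2 <= b].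

Lemma sepC x y : sep x y = sep y x.
Proof. by rewrite /sep minC maxC. Qed.

Lemma sep_sub x y z : x.1 <= y.1 -> y.2 <= x.2 -> sep z x -> sep z y.
Proof.
rewrite /sep => xy yx; rewrite !ge_min !le_max.
move=> /orP[/orP[->//|H]|/orP[H|H]].
- by rewrite (le_trans H xy) !orbT.
- by rewrite (le_trans yx H) !orbT.
- by rewrite (le_trans yx (le_trans H xy)) !orbT.
Qed.

(** Lists of intervals can be concatenated and refined, which is awkward for the indexed families of
    the definition. A common point of two open intervals contradicts [sep], so separated lists are
    disjoint families. *)
Lemma abs_continuous_seq a b f : abs_continuous a b f ->
  forall e, 0 < e -> exists2 d, 0 < d &
    forall s : seq (R * R), all (in_segment a b) s -> pairwise sep s ->
      \sum_(x <- s) (x.2 - x.1) < d -> \sum_(x <- s) `|f x.2 - f x.1| < e.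
Proof.
move=> acf e e0; have [r r0 H] := acf e e0; exists r => // s sab seps.
rewrite 2!(big_tnth _ _ s).
pose p i := tnth (in_tuple s) i.
apply: (H _ (fun i => (p i).1) (fun i => (p i).2)); rewrite {}/p.
- move=> i; have /allP/(_ (tnth (in_tuple s) i)) := sab.
  by rewrite mem_tnth => /(_ isT)/and3P[].
- move=> i j _ _ [x [/=]]; rewrite !in_itv/= => /andP[ui iv] /andP[uj jv].
  have key (k l : 'I_(size s)) : (k < l)%N -> sep (tnth (in_tuple s) k) (tnth (in_tuple s) l).
    move=> kl; have /(pairwiseP (0, 0)) := seps.
    by move=> /(_ k l); rewrite !inE !ltn_ord kl -!(tnth_nth _ (in_tuple s)); apply.
  have nsep : ~~ sep (tnth (in_tuple s) i) (tnth (in_tuple s) j).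
    rewrite /sep -ltNge lt_min !gt_max.
    by rewrite (lt_trans ui iv) (lt_trans uj iv) (lt_trans ui jv) (lt_trans uj jv).
  have [ij|ji|/val_inj//] := ltngtP i j.
    by rewrite key in nsep.
  by rewrite sepC key in nsep.
Qed.

Fixpoint steps (a : R) (s : seq R) : seq (R * R) :=
  if s is x :: s' then (a, x) :: steps x s' else [::].

Lemma variation_steps a b f s :
  variation a b f s = \sum_(x <- steps a s) `|f x.2 - f x.1|.
Proof.
elim: s a => [|x s ih] a; first by rewrite /variation /= !big_nil.
rewrite /= big_cons/= -ih /variation/= big_nat_recl//=.
Qed.

Lemma steps_valid a b s : itv_partition a b s ->
  [/\ all (in_segment a b) (steps a s), pairwise sep (steps a s) &
    \sum_(x <- steps a s) (x.2 - x.1) = b - a].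
Proof.
elim: s a => [|x s ih] a abs /=.
  by rewrite big_nil (itv_partition_nil abs) subrr.
have [|H1 H2 H3] := ih x; first exact: itv_partition_cons abs.
have ax : a < x by case: abs => /= /andP[].
have xb : x <= b by exact: itv_partition_le (itv_partition_cons abs).
rewrite big_cons H3 H2/= {1}/in_segment/= lexx (ltW ax) xb/= andbT; split.
- apply/allP => y ys; have /allP/(_ _ ys)/and3P[xy yy yb] := H1.
  by rewrite /in_segment yy yb (le_trans (ltW ax)).
- apply/allP => y ys; have /allP/(_ _ ys)/and3P[xy yy yb] := H1.
  by rewrite /sep/= ge_min !le_max xy !orbT.
- by ring.
Qed.

(* The intervals in t are replaced one by one by the pieces of a partition, collected in s, and
   the supremum over that partition is taken before passing to the next one. *)
Lemma total_variation_seq a b f e d :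
  (forall s : seq (R * R), all (in_segment a b) s -> pairwise sep s ->
      \sum_(x <- s) (x.2 - x.1) < d -> \sum_(x <- s) `|f x.2 - f x.1| < e) ->
  forall t s : seq (R * R), all (in_segment a b) (s ++ t) -> pairwise sep (s ++ t) ->
    \sum_(x <- s ++ t) (x.2 - x.1) < d ->
  ((\sum_(x <- s) `|f x.2 - f x.1|)%:E +
    \sum_(x <- t) total_variation x.1 x.2 f <= e%:E)%E.
Proof.
move=> H; elim=> [|x t ih] s sab seps sd.
  rewrite big_nil adde0 lee_fin ltW//; apply: H; by rewrite cats0 in sab seps sd.
rewrite big_cons.
have TV0 : (0 <= \sum_(y <- t) total_variation y.1 y.2 f)%E.
  rewrite big_seq; apply: sume_ge0 => y yt; apply: total_variation_ge0.
  have /allP/(_ y) := sab.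
  by rewrite mem_cat inE yt !orbT => /(_ isT)/and3P[].
have xab : in_segment a b x.
  by have /allP/(_ x) := sab; rewrite mem_cat inE eqxx orbT; apply.
have /and3P[ax xx xb] := xab.
move: sab; rewrite all_cat/= => /and3P[sab _ tab].
move: seps; rewrite pairwise_cat/= => /and3P[/allrelP sxt seps /andP[xt sept]].
have sx y : y \in s -> sep y x by move=> ys; apply: sxt; rewrite ?inE ?eqxx.
have st y z : y \in s -> z \in t -> sep y z.
  by move=> ys zt; apply: sxt => //; rewrite inE zt orbT.
move: sd; rewrite big_cat/= big_cons => sd.
have key l : itv_partition x.1 x.2 l ->
  ((\sum_(x <- s) `|f x.2 - f x.1|)%:E + (variation x.1 x.2 f l)%:E +
    \sum_(x <- t) total_variation x.1 x.2 f <= e%:E)%E.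
  move=> xl; have [l1 l2 l3] := steps_valid xl.
  rewrite -EFinD variation_steps -big_cat/=; apply: ih.
  - rewrite !all_cat sab tab andbT/=; apply/allP => y /(allP l1)/and3P[xy yy yx].
    by rewrite /in_segment yy (le_trans ax)//= (le_trans yx).
  - rewrite pairwise_cat pairwise_cat seps l2 sept !andbT/=.
    rewrite allrel_catl; apply/andP; split; [apply/andP; split|]; apply/allrelP => y z yI zI.
    + exact: st.
    + rewrite sepC; have /and3P[xy yy yx] := allP l1 _ yI.
      by apply: (sep_sub xy yx); rewrite sepC; exact: (allP xt).
    + have /and3P[xy yy yx] := allP l1 _ zI.
      by apply: (sep_sub xy yx); exact: sx.
  - rewrite !big_cat/= l3; lra.
(* One partition suffices: [key] bounds the sum by the finite e. Finiteness then allows it to be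
   moved across the inequality. *)
have Tfin : (\sum_(y <- t) total_variation y.1 y.2 f)%E \is a fin_num.
  have [l xl] : exists l, itv_partition x.1 x.2 l.
    move: xx; rewrite le_eqVlt => /predU1P[->|xx]; last by exists [:: x.2]; exact: itv_partition1.
    by exists [::]; split.
  move: TV0 (key l xl); rewrite -EFinD.
  set T := (X in (0%R <= X)%E); rewrite -/T; clearbody T.
  by case: T.
rewrite -(fineK Tfin) in key *.
set S := (\sum_(x <- s) _) in key *; set T := fine _ in key *.
suff : (total_variation x.1 x.2 f <= (e - S - T)%:E)%E.
  move=> TVx; rewrite addeA; apply: le_trans (_ : _ <= (S + (e - S - T) + T)%:E)%E _.
    by rewrite !EFinD leeD// leeD.
  by rewrite lee_fin; lra.
apply: ge_ereal_sup => _ [_ [l xl] <-] <-.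
by have := key l xl; rewrite -!EFinD !lee_fin; lra.
Qed.

(** An interval shorter than the modulus for e = 1 has variation at most 1, by [total_variation_seq]
    with a single interval; additivity then adds up finitely many steps. *)
Lemma abs_continuous_TV_fin a b f : a <= b -> abs_continuous a b f ->
  total_variation a b f \is a fin_num.
Proof.
move=> ab acf; have [r r0 H] := abs_continuous_seq acf ltr01.
have TVr x y : a <= x -> x <= y -> y <= b -> y - x < r ->
    total_variation x y f \is a fin_num.
  move=> ax xy yb xyr; rewrite ge0_fin_numE ?total_variation_ge0//.
  have := @total_variation_seq a b f _ _ H [:: (x, y)] [::].
  rewrite /= !big_cons !big_nil/= /in_segment/= ax xy yb add0e !adde0 addr0.
  by move=> /(_ isT isT xyr)/le_lt_trans; apply; rewrite ltry.
have step (n : nat) : forall x, a <= x -> x <= b -> x <= a + n%:R * (r / 2) ->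
    total_variation a x f \is a fin_num.
  elim: n => [|n ih] x ax xb.
    rewrite mul0r !addr0 => xa.
    have -> : x = a by [apply/eqP; rewrite eq_le xa].
    by rewrite total_variationxx.
  move=> xn; have [xr|rx] := leP x (a + n%:R * (r / 2)); first exact: ih.
  set y := a + n%:R * (r / 2) in rx.
  have ay : a <= y by rewrite lerDl mulr_ge0// divr_ge0// ltW.
  have yb : y <= b by rewrite (le_trans (ltW rx)).
  rewrite (total_variationD f ay (ltW rx)) fin_numD ih//=; apply: TVr => //.
    exact: ltW.
  have : x - y <= r / 2.
    move: xn; rewrite /y -natr1 mulrDl mul1r; lra.
  by move=> /le_lt_trans; apply; rewrite ltr_pdivrMr// ltr_pMr// ltr1n.
have [n hn] : exists n : nat, b <= a + n%:R * (r / 2).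
  exists (Num.truncn ((b - a) / (r / 2))).+1.
  rewrite -lerBlDl -ler_pdivrMr ?divr_gt0// ltW//.
  by rewrite truncnS_gt.
exact: (step n).
Qed.

Lemma fine_TVB a b f x y : abs_continuous a b f -> a <= x -> x <= y -> y <= b ->
  fine (total_variation a y f) - fine (total_variation a x f) =
  fine (total_variation x y f).
Proof.
move=> acf ax xy yb; rewrite (total_variationD f ax xy) fineD; first by ring.
  exact/(abs_continuous_TV_fin ax)/(abs_continuousS (lexx _) (le_trans xy yb) acf).
exact/(abs_continuous_TV_fin xy)/(abs_continuousS ax yb acf).
Qed.

Lemma fine_TV_homo a b f x y : abs_continuous a b f -> a <= x -> x <= y -> y <= b ->
  `|f y - f x| <=
  fine (total_variation a y f) - fine (total_variation a x f).
Proof.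
move=> acf ax xy yb; rewrite (fine_TVB acf)//.
rewrite -lee_fin fineK ?total_variation_ge//.
exact/(abs_continuous_TV_fin xy)/(abs_continuousS ax yb acf).
Qed.

(* Degenerate intervals are discarded: on the others, disjointness as sets
   is the separation of the end points. *)
Lemma abs_continuous_TV a b f : abs_continuous a b f ->
  abs_continuous a b (fun x => fine (total_variation a x f)).
Proof.
(* Suprema over partitions only keep a non-strict bound, so the modulus is taken at e / 2. *)
move=> acf e e0; have e20 : 0 < e / 2 by rewrite divr_gt0.
have [r r0 H] := abs_continuous_seq acf e20; exists r => // n u v uv tuv uvr.
pose t := [seq (u i, v i) | i <- [seq i <- index_enum 'I_n | u i < v i]].
have tE (F : R * R -> R) : (forall x, F (x, x) = 0) ->
    \sum_(i < n) F (u i, v i) = \sum_(x <- t) F x.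
  move=> F0; rewrite big_map big_filter [LHS](bigID (fun i => u i < v i))/=.
  rewrite [X in _ + X]big1 ?addr0// => i; rewrite -leNgt => vu.
  have [_ uvi _] := uv i.
  have -> : v i = u i by apply/eqP; rewrite eq_le vu.
  exact: F0.
apply: le_lt_trans (_ : e / 2 < e); last by lra.
rewrite (eq_bigr (fun i => fine (total_variation (u i) (v i) f))); last first.
  move=> i _; have [au uvi vb] := uv i; rewrite (fine_TVB acf)// ger0_norm//.
  by rewrite fine_ge0// total_variation_ge0.
rewrite (tE (fun x => fine (total_variation x.1 x.2 f))); last first.
  by move=> x; rewrite total_variationxx.
have tab : all (in_segment a b) t.
  by apply/allP => _ /mapP[i _ ->]; have [au uvi vb] := uv i; rewrite /in_segment/= au uvi.
have := @total_variation_seq a b f _ _ H t [::].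
rewrite cat0s big_nil add0e => /(_ tab) K.
rewrite -lee_fin -sumEFin; apply: le_trans (K _ _).
- rewrite le_eqVlt; apply/orP; left; apply/eqP.
  apply: eq_big_seq => x /(allP tab)/and3P[ax xx xb]; rewrite fineK//.
  exact/(abs_continuous_TV_fin xx)/(abs_continuousS ax xb acf).
- rewrite pairwise_map; apply: (@sub_in_pairwise _ (fun i => u i < v i) (fun i j => i != j)).
  + move=> i j; rewrite !unfold_in => ui uj ij; rewrite /sep/= leNgt; apply/negP => nsep.
    (* Without separation the midpoint of the overlap would lie in both intervals. *)
    pose m := (Num.min (v i) (v j) + Num.max (u i) (u j)) / 2.
    move: tuv => /trivIsetP/(_ i j I I ij)/seteqP[/(_ m)]; rewrite {}/m.
    rewrite /= !in_itv/=.
    move: nsep; rewrite lt_min !gt_max => /andP[/andP[a1 a2] /andP[a3 a4]] Hf _.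
    apply: Hf; set M := Num.min _ _; set N := Num.max _ _.
    have [M1 M2] : M <= v i /\ M <= v j by rewrite !ge_min !lexx orbT.
    have [N1 N2] : u i <= N /\ u j <= N by rewrite !le_max !lexx orbT.
    have NM : N < M by rewrite lt_min !gt_max a1 a2 a3 a4.
    clearbody M N; split; apply/andP; split; lra.
  + by rewrite all_filter; apply/allP => i _; apply/implyP.
  + by rewrite -uniq_pairwise filter_uniq// index_enum_uniq.
- by rewrite -(tE (fun x => x.2 - x.1))// => x; rewrite subrr.
Qed.

End AbsolutelyContinuous.

(** * The fundamental theorem of calculus for absolutely continuous functions *)

Section grid.
Context {R : realType}.
Implicit Types a b : R.

(** For a < b the cells j = 0, ..., k tile []a, b]]. They are open on the left, like the intervals
    whose Lebesgue-Stieltjes measure is an increment. *)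
Definition cell a b (k j : nat) : set R :=
  `]a + (b - a) / k.+1%:R * j%:R, a + (b - a) / k.+1%:R * j.+1%:R]%classic.

Lemma cell_endpoints a b k j : a <= b -> (j < k.+1)%N ->
  [/\ a <= a + (b - a) / k.+1%:R * j%:R,
      a + (b - a) / k.+1%:R * j%:R <= a + (b - a) / k.+1%:R * j.+1%:R &
      a + (b - a) / k.+1%:R * j.+1%:R <= b].
Proof.
move=> ab jk; have h0 : 0 <= (b - a) / k.+1%:R by rewrite divr_ge0// subr_ge0.
split; first by rewrite lerDl mulr_ge0.
  by rewrite lerD2l ler_wpM2l// ler_nat.
rewrite -lerBrDl mulrAC ler_pdivrMr// ler_wpM2l ?subr_ge0// ler_nat//.
Qed.

Lemma trivIset_cell a b k (P : {pred 'I_k.+1}) : a <= b ->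
  trivIset P (fun j : 'I_k.+1 => cell a b k j).
Proof.
move=> ab; apply: (@sub_trivIset _ _ _ setT) => //.
have h0 : 0 <= (b - a) / k.+1%:R by rewrite divr_ge0// subr_ge0.
have key (i j : 'I_k.+1) : (i < j)%N -> cell a b k i `&` cell a b k j = set0.
  move=> ij; apply/seteqP; split => // x [/=]; rewrite /cell /= !in_itv/=.
  move=> /andP[_ xi] /andP[jx _].
  have : a + (b - a) / k.+1%:R * i.+1%:R <= a + (b - a) / k.+1%:R * j%:R.
    by rewrite lerD2l ler_wpM2l// ler_nat.
  by move=> /(le_trans xi)/le_lt_trans/(_ jx); rewrite ltxx.
move=> i j _ _ [x xij]; apply/val_inj => /=.
have [ij|ji|//] := ltngtP (i : nat) j.
  by have := key _ _ ij; move/seteqP => [/(_ x xij)].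
by have := key _ _ ji; rewrite setIC => /seteqP[/(_ x xij)].
Qed.

Lemma in_cell a b k x : a < b -> a < x -> x <= b ->
  exists2 j, (j < k.+1)%N & cell a b k j x.
Proof.
move=> ab ax xb; pose P j := x <= a + (b - a) / k.+1%:R * j%:R.
have Pk : exists j, P j.
  by exists k.+1; rewrite /P divfK ?pnatr_eq0// addrC subrK.
have [[|j] Pj jmin] := ex_minnP Pk.
  by move: Pj; rewrite /P mulr0 addr0 leNgt ax.
exists j.
  by apply: jmin; rewrite /P divfK ?pnatr_eq0// addrC subrK.
rewrite /cell/= in_itv/= -/(P j.+1) Pj andbT ltNge; apply/negP => /jmin.
by rewrite ltnn.
Qed.

End grid.

(** * Densities of absolutely continuous functions *)

Section density.
Context {R : realType}.
Notation mu := (@lebesgue_measure R).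
Implicit Types (a b : R) (V F : R -> R).

Lemma lebesgue_stieltjes_itv (W : cumulative R R) x y : x <= y ->
  lebesgue_stieltjes_measure W `]x, y]%classic = (W y - W x)%:E.
Proof.
move=> xy; rewrite /lebesgue_stieltjes_measure /measure_extension/=.
by rewrite measurable_mu_extE/= ?wlength_itv_bnd//; exact: is_ocitv.
Qed.

(* The cells of the uniform grid contained in an open set U exhaust the part of U in ]a, b] as the
   mesh tends to 0, and absolute continuity bounds their total W-increment. *)
Lemma null_lebesgue_stieltjes a b (W : cumulative R R) : a < b ->
  abs_continuous a b W ->
  forall A : set R, measurable A -> mu A = 0%E ->
    lebesgue_stieltjes_measure W (A `&` `]a, b]) = 0%E.
Proof.
move=> ab acW A mA A0.
pose nu : {measure set (measurableTypeR R) -> \bar R} := lebesgue_stieltjes_measure W.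
rewrite -[LHS]/(nu (A `&` `]a, b])).
apply/eqP; rewrite eq_le measure_ge0 andbT; apply/lee_addgt0Pr => e e0.
rewrite add0e; have [r r0 H] := acW _ e0.
have [U [oU AU Ur]] := lebesgue_regularity_outer mA (ltac:(by rewrite A0 ltry) : (mu A < +oo)%E) r0.
have mU : measurable U by exact: open_measurable.
have {}Ur : (mu U < r%:E)%E.
  have -> : U = A `|` (U `\` A) by rewrite setDUK.
  have /le_lt_trans : (mu (A `|` (U `\` A)) <= mu A + mu (U `\` A))%E.
    by apply: measureU2 => //; exact: measurableD.
  by apply; rewrite A0 add0e.
pose P k (j : 'I_k.+1) : bool := `[< cell a b k j `<=` U >].
pose Wk k := \big[setU/set0]_(j < k.+1 | P k j) cell a b k j.
have mcell k j : measurable (cell a b k j) by exact: measurable_itv.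
have mWk k : measurable (Wk k) by exact: bigsetU_measurable.
have nuWk k : (nu (Wk k) <= e%:E)%E.
  have tP := @trivIset_cell R a b k (P k) (ltW ab).
  have := @measure_bigsetU_ord_cond _ _ _ nu k.+1 (P k) (fun j : 'I_k.+1 => cell a b k j)
    (fun j _ => mcell k j) tP.
  rewrite -/(Wk k) => ->.
  pose u (j : 'I_k.+1) := a + (b - a) / k.+1%:R * j%:R.
  (* A cell not contained in [U] is collapsed to a point, so that absolute continuity applies to the
     family of all indices at once. *)
  pose v (j : 'I_k.+1) := if P k j then a + (b - a) / k.+1%:R * j.+1%:R else u j.
  have uv i : [/\ a <= u i, u i <= v i & v i <= b].
    have [h1 h2 h3] := cell_endpoints (ltW ab) (ltn_ord i).
    by rewrite /v; case: ifP => _; split => //; exact: le_trans h2 h3.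
  rewrite (eq_bigr (fun j => (W (v j) - W (u j))%:E)); last first.
    move=> j Pj; rewrite [LHS]lebesgue_stieltjes_itv; first by rewrite /v Pj.
    by have [] := cell_endpoints (ltW ab) (ltn_ord j).
  rewrite sumEFin lee_fin big_mkcond/=.
  apply: le_trans (ltW (H _ u v uv _ _)).
  - apply: ler_sum => j _; case: ifP => // _; exact: ler_norm.
  - move=> i j _ _ [x [xi xj]].
    have sub l : `]u l, v l[ `<=` cell a b k l.
      move=> y; rewrite /= /cell/= !in_itv/= => /andP[uy yv]; rewrite -/(u l) uy/=.
      move: yv; rewrite /v; case: ifP => [_ /ltW//|_ yu].
      by move: (lt_trans uy yu); rewrite ltxx.
    apply: (trivIset_cell (P := predT) (ltW ab)) => //.
    by exists x; split; exact: sub.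
  - rewrite -lte_fin; apply: le_lt_trans Ur.
    apply: (@le_trans _ _ (mu (Wk k))); last first.
      apply: le_measure; [by rewrite inE; exact: mWk|by rewrite inE|].
      rewrite /Wk; elim/big_ind: _ => [//|X Y XU YU|j /asboolP//].
      by rewrite subUset.
    have := @measure_bigsetU_ord_cond _ _ _ mu k.+1 (P k) (fun j : 'I_k.+1 => cell a b k j)
      (fun j _ => mcell k j) tP.
    rewrite -/(Wk k) => ->.
    rewrite -sumEFin [leRHS]big_mkcond/=; apply: lee_sum => j _.
    rewrite /v; case: ifP => _; last by rewrite subrr.
    rewrite /cell lebesgue_measure_itv/= lte_fin.
    by case: ifPn => //; rewrite -leNgt lee_fin subr_le0.
(* Successive grids are not nested, so the sets [Wk] need not increase. The tail intersections do;
   [T K] lies in [Wk K], and a point of [U] in []a, b]] belongs to [T K] once the mesh is below its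
   distance to the complement. *)
pose T K := \bigcap_(k in [set k | (K <= k)%N]) Wk k.
have mT K : measurable (T K) by apply: bigcap_measurable => //; exists K => /=.
have UT : U `&` `]a, b] `<=` \bigcup_K T K.
  move=> x [Ux /=]; rewrite in_itv/= => /andP[ax xb].
  have [d/= d0 dU] := oU x Ux.
  have [K hK] : exists K : nat, (b - a) / K.+1%:R < d.
    exists (Num.truncn ((b - a) / d)).
    by rewrite ltr_pdivrMr// mulrC -ltr_pdivrMr// truncnS_gt.
  exists K => // k /= Kk; have [j jk xj] := in_cell k ab ax xb.
  rewrite /Wk (bigD1 (Ordinal jk))/=; first by left.
  apply/asboolP => y; rewrite /cell/= in_itv/= => /andP[jy yj]; apply: dU.
  move: xj; rewrite /cell/= in_itv/= => /andP[jx xj].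
  have hk : (b - a) / k.+1%:R < d.
    apply: le_lt_trans hK; rewrite ler_wpM2l ?subr_ge0 ?(ltW ab)//.
    by rewrite lef_pV2 ?posrE// ler_nat.
  move: hk jy yj jx xj; rewrite -(natr1 j) mulrDr mulr1 /ball/=.
  set h := (b - a) / _; set hj := h * j%:R; clearbody hj; clearbody h.
  by move=> *; rewrite ltr_norml; apply/andP; split; lra.
have ndT : nondecreasing_seq T.
  move=> m n mn; apply/subsetPset => x Tx k /= nk; apply: Tx => /=.
  exact: leq_trans nk.
have mUT : measurable (\bigcup_K T K) by exact: bigcup_measurable.
apply: (@le_trans _ _ (nu (\bigcup_K T K))).
  apply: le_measure; rewrite ?inE//; first exact: measurableI.
  by apply: subset_trans UT; exact: setSI.
have cv := nondecreasing_cvg_mu (mu := nu) mT mUT ndT.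
rewrite -(cvg_lim _ cv)//; apply: lime_le; first by apply/cvg_ex; exists (nu (\bigcup_K T K)).
near=> K; apply: le_trans (nuWk K).
apply: le_measure; [by rewrite inE; exact: mT|by rewrite inE; exact: mWk|].
by move=> x; apply => /=.
Unshelve. all: by end_near. Qed.

Lemma density_nondecreasing a b V : a < b -> abs_continuous a b V ->
  (forall x y, a <= x -> x <= y -> y <= b -> V x <= V y) ->
  exists2 g : R -> R, mu.-integrable setT (EFin \o g) &
    forall x y, a <= x -> x <= y -> y <= b ->
      \int[mu]_(t in `]x, y]) g t = V y - V x.
Proof.
move=> ab acV ndV.
(* Clamping to [[a, b]] extends V by constants to a nondecreasing right-continuous function on the
   line, as a Lebesgue-Stieltjes measure requires. *)
pose cl x := Num.max a (Num.min b x).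
have acl x : a <= cl x by rewrite /cl le_max lexx.
have clb x : cl x <= b by rewrite /cl ge_max (ltW ab) ge_min lexx.
have clE x : a <= x -> x <= b -> cl x = x.
  by move=> ax xb; rewrite /cl min_r// max_r.
have clnd x y : x <= y -> cl x <= cl y.
  by move=> xy; rewrite /cl le_max2// le_min2.
have cllip x y : x <= y -> cl y - cl x <= y - x.
  move=> xy; rewrite /cl /Num.max /Num.min; do ! case: ifPn; rewrite -?leNgt; lra.
pose W x := V (cl x).
have WE x : a <= x -> x <= b -> W x = V x by move=> ax xb; rewrite /W clE.
have ndW : nondecreasing W by move=> x y xy; apply: ndV; rewrite ?clnd.
have rcW : forall x, W y @[y --> x^'+] --> W x.
  move=> x; apply/cvgrPdist_lt => e e0.
  have [d d0 H] := abs_continuous_modulus acV e0.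
  near=> y; have xy : x <= y by near: y; exact: nbhs_right_ge.
  rewrite distrC; apply: H; rewrite ?clnd//.
  rewrite (le_lt_trans (cllip _ _ xy))// ltrBlDl; near: y.
  by apply: nbhs_right_lt; rewrite ltrDl.
pose cW := isCumulative.Build R _ R W ndW rcW.
pose W' : cumulative R R := HB.pack W cW.
have acW : abs_continuous a b W'.
  move=> e e0; have [r r0 H] := acV e e0; exists r => // n u v uv tuv uvr.
  rewrite (eq_bigr (fun i => `|V (v i) - V (u i)|)) ?H// => i _.
  have [au uvi vb] := uv i; rewrite -[W' (v i)]/(W (v i)) -[W' (u i)]/(W (u i)).
  by rewrite (WE _ (le_trans au uvi) vb) (WE _ au (le_trans uvi vb)).
pose nu : {measure set (measurableTypeR R) -> \bar R} := lebesgue_stieltjes_measure W'.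
have nuI x y : x <= y -> nu `]x, y]%classic = (W y - W x)%:E.
  exact: lebesgue_stieltjes_itv.
have mD : @measurable _ (measurableTypeR R) `]a, b]%classic by exact: measurable_itv.
have nuD : (nu `]a, b]%classic < +oo)%E by rewrite nuI ?ltry// ltW.
pose nuf : {finite_measure set (measurableTypeR R) -> \bar R} := mfrestr mD nuD.
have dom : nuf `<< mu.
  apply/null_content_dominatesP => A mA A0.
  exact: (null_lebesgue_stieltjes ab acW).
have [f [f0 ffin fint fE]] := @radon_nikodym_sigma_finite _ _ _ mu nuf dom.
have Ef : EFin \o (fine \o f) = f by apply/funext => x /=; rewrite fineK.
exists (fine \o f); first by rewrite Ef.
move=> x y ax xy yb.
have -> : \int[mu]_(t in `]x, y]) (fine \o f) t = fine (\int[mu]_(t in `]x, y]) f t)%E.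
  by rewrite /Rintegral; congr fine; apply: eq_integral => t _; rewrite /= fineK.
rewrite -fE; last exact: measurable_itv.
rewrite /= /mfrestr /mrestr setIidl ?nuI// ?WE//=.
- exact: le_trans xy yb.
- exact: le_trans ax xy.
- by apply: subset_itv; rewrite bnd_simp.
Unshelve. all: by end_near. Qed.

(** F = V - (V - F) with V the variation from a; both terms are nondecreasing because
    [|F y - F x| <= V y - V x]. *)
Lemma density_abs_continuous a b F : a < b -> abs_continuous a b F ->
  exists2 g : R -> R, mu.-integrable setT (EFin \o g) &
    forall x y, a <= x -> x <= y -> y <= b ->
      \int[mu]_(t in `]x, y]) g t = F y - F x.
Proof.
move=> ab acF; pose V x := fine (total_variation a x F).
have acV : abs_continuous a b V := abs_continuous_TV acF.
have FV x y : a <= x -> x <= y -> y <= b -> `|F y - F x| <= V y - V x.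
  exact: fine_TV_homo.
have acVF : abs_continuous a b (V \+ (fun x => -1 * F x)).
  apply: abs_continuousD => //; apply: abs_continuousM => //.
  by apply: (@abs_continuous_lip _ _ _ _ 0) => x y _ _ _; rewrite subrr normr0 mul0r.
have [g1 ig1 g1E] := density_nondecreasing ab acV (fun x y ax xy yb =>
  ltac:(by rewrite -subr_ge0 (le_trans _ (FV x y ax xy yb)))).
have [|g2 ig2 g2E] := density_nondecreasing ab acVF.
  move=> x y ax xy yb /=; have := FV x y ax xy yb.
  by rewrite ler_norml => /andP[_]; lra.
exists (g1 \- g2).
  have -> : EFin \o (g1 \- g2) = ((EFin \o g1) \- (EFin \o g2))%E by [].
  exact: integrableB.
move=> x y ax xy yb; rewrite RintegralB ?g1E ?g2E//=; first ring.
  exact: integrableS ig1.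
exact: integrableS ig2.
Qed.

Lemma density_derivable a b F (g : R -> R) : mu.-integrable setT (EFin \o g) ->
  (forall x y, a <= x -> x <= y -> y <= b ->
      \int[mu]_(t in `]x, y]) g t = F y - F x) ->
  {ae mu, forall x, a < x -> x < b -> derivable F x 1 /\ derive1 F x = g x}.
Proof.
move=> ig gE.
have lg : locally_integrable setT g by apply: open_integrable_locally => //; exact: openT.
have igy (y : R) : mu.-integrable [set` Interval (BRight a) (BRight y)] (EFin \o g).
  by apply: integrableS ig.
have := @FTC1 _ g (BRight a) igy lg.
apply: filterS; first exact: (ae_filter_ringOfSetsType mu).
move=> x H ax xb.
pose G (y : R) : R := \int[mu]_(t in [set` Interval (BRight a) (BRight y)]) g t.
have GE y : a < y -> y < b -> G y + F a = F y.
  by move=> ay yb; rewrite /G (gE _ _ (lexx a) (ltW ay) (ltW yb)) subrK.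
have {H} : derivable G x 1 /\ derive1 G x = g x by apply: H; rewrite ?bnd_simp ?lte_fin.
clearbody G => -[dG G'].
have near_x : \forall y \near x, G y + F a = F y.
  by near=> y; apply: GE; near: y; [exact: lt_nbhsr|exact: lt_nbhsl].
have dGa : is_derive x 1 (fun y => G y + F a) (g x).
  rewrite -[g x]addr0; apply: is_deriveD.
  by rewrite -G' derive1E; exact/derivableP.
have [dF DF] := near_eq_is_derive near_x dGa.
by split => //; rewrite derive1E.
Unshelve. all: by end_near. Qed.

Lemma integrable_ae_eq (A : set R) (f g : R -> \bar R) : measurable A ->
  measurable_fun A g -> ae_eq mu A f g -> mu.-integrable A f -> mu.-integrable A g.
Proof.
move=> mA mg fg /integrableP[mf If]; apply/integrableP; split => //.
suff <- : (\int[mu]_(x in A) `|f x| = \int[mu]_(x in A) `|g x|)%E by [].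
apply: ae_eq_integral => //; [exact: measurableT_comp|exact: measurableT_comp|].
exact: ae_eq_abse fg.
Qed.

(** Densities on growing intervals agree with F' off a single Borel null set N. The function g is F'
    put to 0 on N; at each point it is the eventually constant limit of the truncated densities,
    hence Borel measurable. *)
Lemma abs_continuous_FTC F : (forall a b, abs_continuous a b F) ->
  exists g : R -> R, [/\ measurable_fun setT g,
    {ae mu, forall x, derivable F x 1 /\ derive1 F x = g x},
    forall a b, mu.-integrable `[a, b] (EFin \o g) &
    forall a b, a <= b -> \int[mu]_(t in `[a, b]) g t = F b - F a].
Proof.
move=> acF.
have dens (n : nat) : exists2 g : R -> R, mu.-integrable setT (EFin \o g) &
    forall x y, - n.+1%:R <= x -> x <= y -> y <= n.+1%:R ->
      \int[mu]_(t in `]x, y]) g t = F y - F x.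
  apply: density_abs_continuous => //.
  by rewrite (@lt_trans _ _ 0) ?oppr_lt0 ?ltr0n.
have /choice[G GP] : forall n : nat, exists g : R -> R, mu.-integrable setT (EFin \o g) /\
    forall x y, - n.+1%:R <= x -> x <= y -> y <= n.+1%:R ->
      \int[mu]_(t in `]x, y]) g t = F y - F x.
  by move=> n; have [g ? ?] := dens n; exists g.
have aeG : {ae mu, forall x (n : nat), - n.+1%:R < x -> x < n.+1%:R ->
    derivable F x 1 /\ derive1 F x = G n x}.
  apply/ae_foralln => n; have [iG GE] := GP n.
  exact: density_derivable iG GE.
have [N [mN N0 NG]] := aeG.
have aeN : {ae mu, forall x, ~ N x}.
  by exists N; split => // x /= /contrapT.
have NGE x n : ~ N x -> - n.+1%:R < x -> x < n.+1%:R ->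
    derivable F x 1 /\ derive1 F x = G n x.
  move=> Nx; apply: contrapT => H; apply: Nx; apply: NG => /= H'.
  by apply: H; exact: H'.
have bnd (x : R) : exists n : nat, - n.+1%:R < x /\ x < n.+1%:R.
  exists (Num.truncn `|x|); apply/andP; rewrite -ltr_norml truncnS_gt//.
exists (derive1 F \_ (~` N)).
have mG : measurable_fun setT (derive1 F \_ (~` N)).
  apply: (@measurable_fun_cvg _ _ _ _ (fun n => G n \_ (`]- n.+1%:R, n.+1%:R[ `\` N))).
    move=> n; apply/measurable_restrict => //.
    - exact: measurableD.
    - rewrite setTI; have [iG _] := GP n.
      move/integrableP: iG => [/measurable_EFinP + _].
      exact: measurable_funS.
  move=> x _; apply: cvg_near_cst; have [n [nx xn]] := bnd x.
  near=> m; have nm : (n <= m)%N by near: m; exact: nbhs_infty_ge.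
  have xm : - m.+1%:R < x /\ x < m.+1%:R.
    have nm' : n.+1%:R <= m.+1%:R :> R by rewrite ler_nat.
    by split; [apply: le_lt_trans nx; rewrite lerN2|exact: lt_le_trans nm'].
  have [Nx|Nx] := pselect (N x).
    rewrite /patch; case: ifPn => [/set_mem[_ /(_ Nx)]//|_].
    by case: ifPn => [/set_mem/(_ Nx)|].
  rewrite !patchE !mem_set//=; last by split => //; rewrite in_itv/=; apply/andP.
  by have [_ ->] := NGE x m Nx xm.1 xm.2.
have aeE (n : nat) (A : set R) : A `<=` `]- n.+1%:R, n.+1%:R[ ->
    ae_eq mu A (EFin \o G n) (EFin \o (derive1 F \_ (~` N))).
  move=> An; apply: (@filterS _ _ (ae_filter_ringOfSetsType mu) _ _ _ aeN) => x Nx Ax.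
  rewrite /= patchE mem_set//.
  have := An x Ax; rewrite /= in_itv/= => /andP[nx xn].
  by have [_ ->] := NGE x n Nx nx xn.
have bnd2 (a b : R) : exists n : nat, `[a, b] `<=` `]- n.+1%:R, n.+1%:R[.
  have [n [n1 _]] := bnd a; have [m [_ m2]] := bnd b.
  exists (maxn n m) => x; rewrite /= !in_itv/= => /andP[ax xb].
  have nm' : n.+1%:R <= (maxn n m).+1%:R :> R by rewrite ler_nat ltnS leq_maxl.
  have mm' : m.+1%:R <= (maxn n m).+1%:R :> R by rewrite ler_nat ltnS leq_maxr.
  apply/andP; split; first by apply: lt_le_trans ax; apply: le_lt_trans n1; rewrite lerN2.
  by apply: le_lt_trans xb _; exact: lt_le_trans mm'.
split => //.
- apply: (@filterS _ _ (ae_filter_ringOfSetsType mu) _ _ _ aeN) => x Nx; have [n [n1 n2]] := bnd x.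
  have [dF _] := NGE x n Nx n1 n2; split => //.
  by rewrite patchE mem_set.
- move=> a b; have [n abn] := bnd2 a b; have [iG _] := GP n.
  have mg : measurable_fun `[a, b] (EFin \o (derive1 F \_ (~` N))).
    exact/measurable_EFinP/measurable_funTS.
  by apply: (integrable_ae_eq _ mg (aeE n _ abn)) => //; exact: integrableS iG.
- move=> a b ab; have [n abn] := bnd2 a b; have [iG GE] := GP n.
  have -> : \int[mu]_(t in `[a, b]) (derive1 F \_ (~` N)) t = \int[mu]_(t in `[a, b]) G n t.
    congr fine; apply/esym; apply: ae_eq_integral => //.
    - by apply: measurable_funTS; exact: (measurable_int mu iG).
    - exact/measurable_EFinP/measurable_funTS.
    - exact: aeE abn.
  rewrite -Rintegral_itv_obnd_cbnd; last exact: integrableS iG.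
  have := abn a; rewrite /= !in_itv/= lexx ab/= => /(_ isT)/andP[n1 _].
  have := abn b; rewrite /= !in_itv/= lexx ab/= => /(_ isT)/andP[_ n2].
  by apply: GE => //; exact: ltW.
Unshelve. all: by end_near. Qed.

End density.

(** * L_p norms and calculus on the line *)

Section LpNorm.
Context {R : realType}.
Notation mu := (@lebesgue_measure R).
Implicit Types (p : R) (f g : R -> R).

(* No measurability: derive1n 2 y is only almost everywhere equal to a Borel function. *)
Lemma ge0_integral_le_ae (f g : R -> \bar R) :
  (forall x, 0 <= f x)%E -> (forall x, 0 <= g x)%E ->
  {ae mu, forall x, f x = g x} -> (\int[mu]_x f x <= \int[mu]_x g x)%E.
Proof.
move=> f0 g0 [N [mN N0 fgN]].
(* The integral of a nonnegative function, measurable or not, is a supremum over the simple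
   functions below it. Cutting such a function to 0 on N keeps its integral and puts it below g. *)
rewrite !ge0_integralTE//; apply: ge_ereal_sup => _ [h hf <-].
have mNc : @measurable _ (measurableTypeR R) (~` N) by exact: measurableC.
have -> : sintegral mu h = sintegral mu (proj_nnsfun h mNc).
  rewrite -!integralT_nnsfun; apply: ae_eq_integral => //.
  - exact/measurable_EFinP.
  - exact/measurable_EFinP.
  - exists N; split => // x /=; apply: contra_notP => Nx _.
    by rewrite mindicE mem_set// mulr1.
apply: ereal_sup_ubound; exists (proj_nnsfun h mNc) => //= x.
rewrite mindicE; have [Nx|Nx] := boolP (x \in ~` N); last by rewrite mulr0.
rewrite mulr1; apply: le_trans (hf x) _; rewrite le_eqVlt; apply/orP; left; apply/eqP.
by apply: contrapT => fgx; move/set_mem: Nx; apply; exact: fgN.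
Qed.

Definition pint p f : \bar R := (\int[mu]_x (`|f x| `^ p)%:E)%E.

Lemma pint_ge0 p f : (0 <= pint p f)%E.
Proof. by apply: integral_ge0 => x _; rewrite lee_fin powR_ge0. Qed.

Lemma pint_ae p f g : {ae mu, forall x, f x = g x} -> pint p f = pint p g.
Proof.
move=> fg; apply/eqP; rewrite eq_le; apply/andP; split;
  apply: ge0_integral_le_ae => [x|x|]; rewrite ?lee_fin ?powR_ge0//;
  apply: (@filterS _ _ (ae_filter_ringOfSetsType mu) _ _ _ fg) => x ->//.
Qed.

Lemma Lp_normE p f : Lp_norm p f = (pint p f `^ p^-1)%E.
Proof.
by rewrite /Lp_norm unlock /pint; congr (_ `^ _)%E; apply: eq_integral => x _.
Qed.

Lemma Lp_norm_ge0 p f : (0 <= Lp_norm p f)%E.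
Proof. exact: Lnorm_ge0. Qed.

Lemma Lp_norm_ae p f g : {ae mu, forall x, f x = g x} -> Lp_norm p f = Lp_norm p g.
Proof. by move=> fg; rewrite !Lp_normE (pint_ae p fg). Qed.

Lemma Lp_norm_lty p f : p != 0 -> (Lp_norm p f < +oo)%E = (pint p f < +oo)%E.
Proof.
move=> p0; rewrite Lp_normE; apply/idP/idP; first by apply: lty_poweRy; rewrite invr_eq0.
exact: poweR_lty.
Qed.

Lemma in_LpE p f : in_Lp p f <-> measurable_fun setT f /\ (Lp_norm p f < +oo)%E.
Proof.
rewrite /in_Lp inE/=; split => [/andP[]|[mf ff]].
  by rewrite !inE => mf ff; split; [exact: mf|exact: ff].
by apply/andP; split; rewrite inE.
Qed.

Lemma in_LpP p f : p != 0 -> in_Lp p f <->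
  measurable_fun setT f /\ mu.-integrable setT (fun x => (`|f x| `^ p)%:E).
Proof.
move=> p0; rewrite in_LpE Lp_norm_lty//; split => -[mf].
  move=> pf; split => //; apply/integrableP; split.
    apply/measurable_EFinP; apply: (@measurableT_comp _ _ _ _ _ _ (@powR R ^~ p)) => //.
    exact: measurableT_comp.
  apply: le_lt_trans pf; rewrite /pint le_eqVlt; apply/orP; left; apply/eqP.
  by apply: eq_integral => x _; rewrite gee0_abs// lee_fin powR_ge0.
move=> /integrableP[_]; split => //; apply: le_lt_trans; last eassumption.
rewrite /pint le_eqVlt; apply/orP; left; apply/eqP.
by apply: eq_integral => x _; rewrite gee0_abs// lee_fin powR_ge0.
Qed.

Lemma Lp_normD p f g : 1 <= p -> measurable_fun setT f -> measurable_fun setT g ->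
  (Lp_norm p (f \+ g)%R <= Lp_norm p f + Lp_norm p g)%E.
Proof. by move=> p1 mf mg; apply: eminkowski. Qed.

Lemma Lp_normN p f : Lp_norm p (\- f)%R = Lp_norm p f.
Proof.
by rewrite !Lp_normE /pint; congr (_ `^ _)%E; apply: eq_integral => x _ /=; rewrite normrN.
Qed.

Lemma in_LpD p f g : 1 <= p -> in_Lp p f -> in_Lp p g -> in_Lp p (f \+ g).
Proof.
move=> p1 /in_LpE[mf ff] /in_LpE[mg fg]; apply/in_LpE; split; first exact: measurable_funD.
by apply: le_lt_trans (Lp_normD p1 mf mg) _; rewrite lte_add_pinfty.
Qed.

Lemma in_LpB p f g : 1 <= p -> in_Lp p f -> in_Lp p g -> in_Lp p (f \- g).
Proof.
move=> p1 ff /in_LpE[mg fg]; apply: (@in_LpD _ f (\- g)) => //.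
by apply/in_LpE; rewrite Lp_normN; split => //; exact: measurableT_comp.
Qed.

End LpNorm.

Section Calculus.
Context {R : realType}.
Notation mu := (@lebesgue_measure R).
Implicit Types (a b c : R) (F f g h q : R -> R).

Lemma bounded_on_segment f a b : continuous f ->
  exists2 M, 0 <= M & forall x, a <= x -> x <= b -> `|f x| <= M.
Proof.
move=> cf; have [ab|ba] := leP a b; last first.
  by exists 0 => // x ax xb; move: (le_lt_trans (le_trans ax xb) ba); rewrite ltxx.
have [c _ H] : exists2 c, c \in `[a, b] & forall t, t \in `[a, b] -> `|f t| <= `|f c|.
  apply: EVT_max => //; apply: continuous_subspaceT => x.
  by apply: continuous_comp; [exact: cf|exact: norm_continuous].
by exists `|f c| => // x ax xb; apply: H; rewrite in_itv/= ax.
Qed.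

Lemma is_derive_continuous f (df : R -> R) :
  (forall x : R, is_derive x 1 f (df x)) -> continuous f.
Proof.
move=> fdf x; apply: differentiable_continuous; apply/derivable1_diffP.
exact: (@ex_derive _ _ _ _ _ _ _ (fdf x)).
Qed.

Lemma C1_mean_value f (df : R -> R) a b : (forall x : R, is_derive x 1 f (df x)) -> a <= b ->
  exists2 c, a <= c /\ c <= b & f b - f a = df c * (b - a).
Proof.
move=> fdf ab; have [|c] := @MVT_segment R f df a b ab.
  by apply: continuous_subspaceT; exact: is_derive_continuous fdf.
by rewrite in_itv/= => /andP[ac cb] E; exists c.
Qed.

Lemma C1_abs_continuous f (df : R -> R) : (forall x : R, is_derive x 1 f (df x)) ->
  continuous df -> forall a b, abs_continuous a b f.
Proof.
move=> fdf cdf a b; have [M M0 HM] := bounded_on_segment a b cdf.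
apply: (@abs_continuous_lip _ _ _ _ M) => x y ax xy yb.
have [c [xc cy] ->] := C1_mean_value fdf xy.
rewrite normrM ler_pM// ?HM//; [exact: le_trans xc|exact: le_trans cy _|].
by rewrite ger0_norm// subr_ge0.
Qed.

Lemma abs_continuous_continuous f : (forall a b, abs_continuous a b f) -> continuous f.
Proof.
move=> acf x; apply/cvgrPdist_lt => e e0.
have [d d0 H] := abs_continuous_modulus (acf (x - 1) (x + 1)) e0.
near=> y; have : `|x - y| < Num.min d 1.
  by near: y; exists (Num.min d 1); rewrite //= lt_min d0 ltr01.
rewrite lt_min => /andP[].
rewrite 2!ltr_norml => /andP[d1 d2] /andP[d3 d4].
rewrite distrC; have [xy|yx] := leP x y.
  by apply: H => //; lra.
by rewrite distrC; apply: H => //; lra.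
Unshelve. all: by end_near. Qed.

Lemma ge0_Rintegral_ae (D : set R) f : measurable D -> mu.-integrable D (EFin \o f) ->
  {ae mu, forall x, D x -> 0 <= f x} -> 0 <= \int[mu]_(x in D) f x.
Proof.
move=> mD /integrableP[mf _] f0.
have -> : \int[mu]_(x in D) f x = \int[mu]_(x in D) `|f x|.
  congr fine; apply: ae_eq_integral => //; first apply/measurable_EFinP.
    by apply: measurableT_comp => //; exact/measurable_EFinP.
  apply: (@filterS _ _ (ae_filter_ringOfSetsType mu) _ _ _ f0) => x fx Dx.
  by rewrite ger0_norm// fx.
exact: Rintegral_ge0.
Qed.

(** F is derivable almost everywhere, so the bound is asked for only at points of derivability;
    elsewhere [derive1] has a default value on which nothing is known. *)
Lemma FTC_ge F h a b : (forall a b, abs_continuous a b F) -> a <= b ->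
  mu.-integrable `[a, b] (EFin \o h) ->
  {ae mu, forall x, a <= x -> x <= b -> derivable F x 1 -> h x <= derive1 F x} ->
  \int[mu]_(x in `[a, b]) h x <= F b - F a.
Proof.
move=> acF ab ih hF; have [g [mg Fg ig <-//]] := abs_continuous_FTC acF.
rewrite -subr_ge0 -RintegralB//.
apply: ge0_Rintegral_ae => //.
  have -> : EFin \o (fun x => g x - h x) = ((EFin \o g) \- (EFin \o h))%E by [].
  exact: integrableB.
apply: (@filterS2 _ _ (ae_filter_ringOfSetsType mu) _ _ _ _ Fg hF) => x [dF Fx] hx.
by rewrite /= in_itv/= => /andP[ax xb]; rewrite subr_ge0 -Fx hx.
Qed.

Lemma ae_derive1_nondecreasing F a b : (forall a b, abs_continuous a b F) -> a <= b ->
  {ae mu, forall x, a <= x -> x <= b -> derivable F x 1 -> 0 <= derive1 F x} ->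
  F a <= F b.
Proof.
move=> acF ab F0; rewrite -subr_ge0.
have := @FTC_ge F (cst 0) a b acF ab _ F0.
rewrite /Rintegral integral0/=; apply; apply: integrable0.
Qed.

Lemma locally_integrable_segment q a b : locally_integrable [set: R] q ->
  mu.-integrable `[a, b] (EFin \o q).
Proof.
move=> [mq _ lq]; apply/integrableP; split.
  exact/measurable_EFinP/measurable_funTS.
by apply: lq => //; exact: segment_compact.
Qed.

Lemma continuous_integrable_segment f a b : continuous f ->
  mu.-integrable `[a, b] (EFin \o f).
Proof.
move=> cf; apply: continuous_compact_integrable; first exact: segment_compact.
exact: continuous_subspaceT.
Qed.

Lemma le_integrableR (D : set R) f g : measurable D -> measurable_fun D f ->
  (forall x, D x -> `|f x| <= `|g x|) ->
  mu.-integrable D (EFin \o g) -> mu.-integrable D (EFin \o f).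
Proof.
by move=> mD mf fg; apply: le_integrable => //; exact/measurable_EFinP.
Qed.

End Calculus.

(** * Pointwise derivatives and powers of the positive part *)

Section Derivatives.
Context {R : realType}.
Implicit Types (f g : R -> R) (x c df dg : R).

Lemma is_derive1D f g x df dg : is_derive x 1 f df -> is_derive x 1 g dg ->
  is_derive x 1 (fun t => f t + g t) (df + dg).
Proof. by move=> fx gx; apply: is_deriveD. Qed.

Lemma is_derive1M f g x df dg : is_derive x 1 f df -> is_derive x 1 g dg ->
  is_derive x 1 (fun t => f t * g t) (df * g x + f x * dg).
Proof.
move=> fx gx; apply: (is_derive_eq (is_deriveM fx gx)).
by rewrite addrC; congr (_ + _); rewrite mulrC.
Qed.

Lemma is_derive1Z f x c df : is_derive x 1 f df ->
  is_derive x 1 (fun t => c * f t) (c * df).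
Proof. by move=> fx; apply: (is_deriveZ c fx). Qed.

Lemma is_derive1_comp' f g x df dg : is_derive (g x) 1 f df -> is_derive x 1 g dg ->
  is_derive x 1 (fun t => f (g t)) (df * dg).
Proof. by move=> fx gx; apply: (is_derive1_comp fx gx). Qed.

Lemma is_derive1_eqval f x df dg : is_derive x 1 f df -> df = dg -> is_derive x 1 f dg.
Proof. by move=> H <-. Qed.

Lemma is_derive1_derive1 f x df : is_derive x 1 f df -> derive1 f x = df.
Proof. by move=> [_ <-]; rewrite derive1E. Qed.

Lemma derivable_is_derive1 f x : derivable f x 1 -> is_derive x 1 f (derive1 f x).
Proof. by move=> fx; rewrite derive1E; exact/derivableP. Qed.

(** Meant for powers of the positive part: one Taylor estimate with quadratic remainder covers both
    sides of the kink at 0. *)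
Lemma is_derive1_quadratic f x df c :
  (forall h, `|h| <= 1 -> `|f (x + h) - f x - df * h| <= c * h ^+ 2) ->
  is_derive x 1 f df.
Proof.
move=> H.
suff cv : (fun h => h^-1 *: ((f \o shift x) (h *: 1) - f x)) @ 0^' --> df.
  split; first by apply/cvg_ex; exists df.
  by apply/cvg_lim => //; exact: cv.
apply/cvgrPdist_le => e e0.
near=> h.
have h0 : h != 0 by near: h; exact: nbhs_dnbhs_neq.
have he : `|h| <= Num.min 1 (e / (`|c| + 1)).
  near: h; apply: dnbhs0_le; rewrite lt_min ltr01/= divr_gt0// ltr_wpDl//.
move: he; rewrite le_min => /andP[h1 he].
rewrite /= /GRing.scale /= mulr1 (addrC h x).
have -> : df - h^-1 * (f (x + h) - f x) = - (h^-1 * (f (x + h) - f x - df * h)) by field.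
rewrite normrN normrM normfV ler_pdivrMl ?normr_gt0//.
apply: le_trans (H h h1) _.
rewrite -real_normK ?num_real// expr2 mulrA mulrC ler_wpM2l//.
apply: (@le_trans _ _ ((`|c| + 1) * `|h|)).
  by rewrite ler_wpM2r// (le_trans (ler_norm _))// lerDl.
by rewrite mulrC -ler_pdivlMr// ltr_wpDl.
Unshelve. all: by end_near. Qed.

Definition pospart x : R := Num.max 0 x.

Lemma pospart_ge0 x : 0 <= pospart x.
Proof. by rewrite /pospart le_max lexx. Qed.

Lemma continuous_pospart : continuous pospart.
Proof. by move=> x; apply: continuous_max; [exact: cst_continuous|exact: id]. Qed.

Lemma is_derive_pospart2 x : is_derive x 1 (fun t => pospart t ^+ 2) (2 * pospart x).
Proof.
apply: (@is_derive1_quadratic _ _ _ 1) => h _; rewrite mul1r /pospart ler_norml.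
by rewrite /Num.max; do 2 case: ifPn; rewrite -?leNgt => *; apply/andP; split; nra.
Qed.

Lemma is_derive_pospart3 x : is_derive x 1 (fun t => pospart t ^+ 3) (3 * pospart x ^+ 2).
Proof.
(* For positive x and x + h the remainder is 3 x h^2 + h^3, and [|h| <= 1] turns the cubic term into
   h^2. *)
apply: (@is_derive1_quadratic _ _ _ (4 * pospart x + 1)) => h.
rewrite ler_norml => /andP[h1 h2]; rewrite /pospart ler_norml.
rewrite /Num.max; do 2 case: ifPn; rewrite -?leNgt => xh x0.
- have -> : (x + h) ^+ 3 - x ^+ 3 - 3 * x ^+ 2 * h = 3 * x * h ^+ 2 + h ^+ 3 by ring.
  have := sqr_ge0 h; set k := h ^+ 2 => k0; have -> : h ^+ 3 = h * k by rewrite /k; ring.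
  by apply/andP; split; nra.
- have -> : 0 ^+ 3 - x ^+ 3 - 3 * x ^+ 2 * h = - x * (x * (x + 3 * h)) by ring.
  have A : 0 <= x * (- h) * (- h - x) by rewrite !mulr_ge0//; lra.
  have B : 0 <= x * x * (- (3 * h) - x) by rewrite !mulr_ge0//; lra.
  have D : 0 <= x * x * x by rewrite !mulr_ge0// ltW.
  have E : 0 <= h * h by rewrite -expr2 sqr_ge0.
  by rewrite expr2; apply/andP; split; lra.
- have -> : (x + h) ^+ 3 - 0 ^+ 3 - 3 * 0 ^+ 2 * h = (x + h) * (x + h) ^+ 2 by ring.
  have kl : (x + h) ^+ 2 <= h ^+ 2 by rewrite ler_sqr ?nnegrE; lra.
  have := sqr_ge0 (x + h); move: kl; set k := (x + h) ^+ 2; set l := h ^+ 2 => kl k0.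
  by apply/andP; split; nra.
- have -> : 0 ^+ 3 - 0 ^+ 3 - 3 * 0 ^+ 2 * h = 0 :> R by ring.
  by have := sqr_ge0 h; set k := h ^+ 2 => k0; apply/andP; split; nra.
Qed.

End Derivatives.

(** * Boundedness of z' from the sign of z z' *)

Section Bounded.
Context {R : realType}.
Implicit Types (z u : R -> R).

Lemma sqr_le_norm (x y : R) : x ^+ 2 <= y ^+ 2 -> `|x| <= `|y|.
Proof.
move=> xy; rewrite -(@ler_pXn2r _ 2) ?nnegrE//.
by rewrite !real_normK ?num_real.
Qed.

(* The hypotheses hold for u = z' when z'' = qz with q >= 0. Either z^2 stays nonincreasing,
   and then so does u^2, or z^2 grows at least linearly, so that |z| >= 1 eventually. *)
Lemma bounded_right z u K : (forall x : R, is_derive x 1 z (u x)) -> continuous u ->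
  (forall a b, a <= b -> z a * u a <= z b * u b) ->
  (forall a b, a <= b -> (forall t, a <= t -> t <= b -> z t * u t <= 0) ->
    u b ^+ 2 <= u a ^+ 2) ->
  (forall a b, a <= b -> (forall t, a <= t -> t <= b -> 1 <= `|z t|) ->
    `|u b - u a| <= K) ->
  exists M : R, forall x, 0 <= x -> `|u x| <= M.
Proof.
move=> dz cu w_nd u_ni uK.
(* Either z u <= 0 on the whole half-line, or z u, being nondecreasing, stays above a positive value
   from [x0] on. *)
have [[x0 [x00 w0]]|H] := pselect (exists x, 0 <= x /\ 0 < z x * u x); last first.
  exists `|u 0| => x x0; apply: sqr_le_norm; apply: u_ni => // t t0 _.
  by rewrite leNgt; apply/negP => wt; apply: H; exists t.
(* Since (z^2)' = 2 z u is at least 2 z(x0) u(x0) to the right of [x0], the square z^2 has grown by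
   at least 1 at [b]. *)
pose b := x0 + (2 * (z x0 * u x0))^-1.
have bx0 : x0 <= b by rewrite lerDl invr_ge0 mulr_ge0// ltW.
have [M1 M10 HM1] := bounded_on_segment 0 b cu.
have zt t : b <= t -> 1 <= `|z t|.
  move=> bt; have x0t := le_trans bx0 bt.
  have dz2 (s : R) : is_derive s 1 (fun t => z t * z t) (2 * (z s * u s)).
    by apply: is_derive1_eqval (is_derive1M (dz s) (dz s)) _; ring.
  have [c [x0c ct] zz] := C1_mean_value dz2 x0t.
  have wc := w_nd _ _ x0c.
  have : 1 <= z t ^+ 2.
    have E : z t ^+ 2 = z x0 ^+ 2 + 2 * (z c * u c) * (t - x0) by rewrite -zz; ring.
    rewrite E; apply: ler_wpDl; first exact: sqr_ge0.
    have tb : (2 * (z x0 * u x0))^-1 <= t - x0 by rewrite lerBrDl.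
    apply: le_trans (_ : 2 * (z x0 * u x0) * (t - x0) <= _).
      have w20 : 0 < 2 * (z x0 * u x0) by rewrite mulr_gt0.
      by rewrite -[leLHS](mulfV (lt0r_neq0 w20)) ler_wpM2l// ltW.
    by rewrite ler_wpM2r ?subr_ge0// ler_wpM2l.
  by move=> z1; rewrite -[leLHS]normr1; apply: sqr_le_norm; rewrite expr1n.
exists (M1 + `|K| + `|u b|) => x x00'.
have [xb|bx] := leP x b.
  by rewrite (le_trans (HM1 _ x00' xb))// -addrA lerDl addr_ge0.
have -> : u x = (u x - u b) + u b by ring.
rewrite (le_trans (ler_normD _ _))// lerD2r//.
rewrite (le_trans (uK b x (ltW bx) _))//; last by rewrite (le_trans (ler_norm _))// lerDr.
by move=> t bt _; exact: zt.
Qed.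

(** The left half-line is treated by reflection: z(-t) has derivative -u(-t), which reverses the
    sign of z u, so the hypothesis for z u >= 0 takes the place of the one for z u <= 0. *)
Lemma bounded_line z u K : (forall x : R, is_derive x 1 z (u x)) -> continuous u ->
  (forall a b, a <= b -> z a * u a <= z b * u b) ->
  (forall a b, a <= b -> (forall t, a <= t -> t <= b -> z t * u t <= 0) ->
    u b ^+ 2 <= u a ^+ 2) ->
  (forall a b, a <= b -> (forall t, a <= t -> t <= b -> 0 <= z t * u t) ->
    u a ^+ 2 <= u b ^+ 2) ->
  (forall a b, a <= b -> (forall t, a <= t -> t <= b -> 1 <= `|z t|) ->
    `|u b - u a| <= K) ->
  exists M : R, forall x, `|u x| <= M.
Proof.
move=> dz cu w_nd u_ni u_nd uK.
have [M1 HM1] := bounded_right dz cu w_nd u_ni uK.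
have dNz (x : R) : is_derive x 1 (fun t => z (- t)) (- u (- x)).
  by apply: is_derive1_eqval (is_derive1_comp' (dz (- x)) (is_deriveNid x 1)) _; ring.
have [||||M2 HM2] := @bounded_right (fun t => z (- t)) (fun t => - u (- t)) K dNz.
- move=> x; apply: continuousN; apply: (@continuous_comp _ _ _ -%R u); last exact: cu.
  exact: oppr_continuous.
- by move=> a b ab; rewrite !mulrN lerN2 w_nd// lerN2.
- move=> a b ab H; rewrite !sqrrN; apply: u_nd; first by rewrite lerN2.
  move=> t bt ta; have := H (- t); rewrite opprK mulrN oppr_le0; apply.
    by rewrite lerNr.
  by rewrite lerNl.
- move=> a b ab H; have -> : - u (- b) - - u (- a) = u (- a) - u (- b) by ring.
  apply: uK; first by rewrite lerN2.
  move=> t bt ta; have := H (- t); rewrite opprK; apply.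
    by rewrite lerNr.
  by rewrite lerNl.
exists (`|M1| + `|M2|) => x; have [x0|x0] := leP 0 x.
  by rewrite (le_trans (HM1 x x0))// (le_trans (ler_norm _))// lerDl.
have := HM2 (- x); rewrite oppr_ge0 ltW// opprK normrN => /(_ isT)/le_trans; apply.
by rewrite (le_trans (ler_norm _))// lerDr.
Qed.

End Bounded.

(** * Integrals of p-th powers *)

Section PowerIntegrals.
Context {R : realType}.
Notation mu := (@lebesgue_measure R).
Implicit Types (p : R) (f g h : R -> R).

Lemma measurable_powR_norm p (D : set R) f : measurable_fun D f ->
  measurable_fun D (fun x => `|f x| `^ p).
Proof.
move=> mf; apply: (@measurableT_comp _ _ _ _ _ _ (@powR R ^~ p)) => //.
exact: measurableT_comp.
Qed.

Lemma pint_norm p f : p != 0 -> pint p f = (Lp_norm p f `^ p)%E.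
Proof.
move=> p0; rewrite Lp_normE -poweRrM mulVf// poweRe1//; exact: pint_ge0.
Qed.

Lemma pint_le_norm p f g (c : R) : 0 < p -> 0 <= c ->
  (Lp_norm p f <= c%:E * Lp_norm p g)%E -> (pint p f <= (c `^ p)%:E * pint p g)%E.
Proof.
move=> p0 c0 fg; rewrite !pint_norm ?gt_eqF//.
apply: (@le_trans _ _ ((c%:E * Lp_norm p g) `^ p)%E).
  apply: gt0_ler_poweR => //; first exact: ltW.
    by rewrite in_itv/= Lp_norm_ge0 leey.
  by rewrite in_itv/= mule_ge0 ?leey ?Lp_norm_ge0.
by rewrite poweRM ?lee_fin ?Lp_norm_ge0// poweR_EFin.
Qed.

Lemma norm_le_pint p f g (c : R) : 0 < p -> 0 <= c ->
  (pint p f <= c%:E * pint p g)%E -> (Lp_norm p f <= (c `^ p^-1)%:E * Lp_norm p g)%E.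
Proof.
move=> p0 c0 fg; rewrite !Lp_normE.
apply: (@le_trans _ _ ((c%:E * pint p g) `^ p^-1)%E).
  apply: gt0_ler_poweR => //; first by rewrite invr_ge0 ltW.
    by rewrite in_itv/= pint_ge0 leey.
  by rewrite in_itv/= mule_ge0 ?leey ?pint_ge0.
by rewrite poweRM ?lee_fin ?pint_ge0// poweR_EFin.
Qed.

Lemma pint_support p f M a b : 0 < p -> a <= b -> measurable_fun setT f ->
  (forall x, `|f x| <= M) -> (forall x, ~ (a <= x <= b) -> f x = 0) ->
  (pint p f <= (M `^ p * (b - a))%:E)%E.
Proof.
move=> p0 ab mf fM f0; have M0 : 0 <= M by rewrite (le_trans _ (fM 0)).
have -> : pint p f = (\int[mu]_(x in `[a, b]) (`|f x| `^ p)%:E)%E.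
  rewrite /pint [RHS]integral_mkcond; apply: eq_integral => x _.
  rewrite patchE; case: ifPn => // /negP; rewrite inE/= in_itv/= => /f0 ->.
  by rewrite normr0 powR0// gt_eqF.
apply: (@le_trans _ _ (\int[mu]_(x in `[a, b]) (cst (M `^ p)%:E) x)%E).
  apply: ge0_le_integral => //.
  - apply/measurable_EFinP; apply: measurable_powR_norm.
    by apply: measurable_funTS.
  - move=> x _; rewrite lee_fin ge0_ler_powR ?nnegrE//; exact: ltW.
rewrite integral_cst//= lebesgue_measure_itv/= lte_fin; case: ifPn => _.
  by rewrite -EFinB -EFinM.
by rewrite mule0 lee_fin mulr_ge0 ?powR_ge0// subr_ge0.
Qed.

(** Monotone convergence. The radii [n.+1] are at least 1, the range in which the cutoff estimates
    hold. *)
Lemma ge0_integral_exhaust h (D : \bar R) : measurable_fun setT h ->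
  (forall x, 0 <= h x) ->
  (forall n : nat, (\int[mu]_(x in `[(- n.+1%:R)%R, (n.+1%:R : R)%R]) (h x)%:E <= D)%E) ->
  (\int[mu]_x (h x)%:E <= D)%E.
Proof.
move=> mh h0 hD.
pose g n (x : R) := ((h \_ (`[(- n.+1%:R)%R, (n.+1%:R : R)%R])) x)%:E.
have gE n : (\int[mu]_x g n x)%E = (\int[mu]_(x in `[(- n.+1%:R)%R, (n.+1%:R : R)%R]) (h x)%:E)%E.
  rewrite [RHS]integral_mkcond; apply: eq_integral => x _.
  by rewrite /g !patchE; case: ifP.
have cv := @cvg_monotone_convergence _ _ _ mu setT measurableT g.
have {cv} : (\int[mu]_x g n x @[n --> \oo] --> \int[mu]_x (h x)%:E)%E.
  have -> : (\int[mu]_x (h x)%:E = \int[mu]_x limn (g^~ x))%E.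
    apply: eq_integral => x _; apply/esym/cvg_lim => //.
    have [k hk] : exists k : nat, `|x| < k.+1%:R.
      by exists (Num.truncn `|x|); rewrite truncnS_gt.
    apply: cvg_near_cst; near=> n; rewrite /g patchE mem_set//= in_itv/= -ler_norml.
    have kn : (k <= n)%N by near: n; exists k.
    by rewrite (le_trans (ltW hk))// ler_nat.
  apply: cv => //.
  - move=> n; apply/measurable_EFinP; apply: (iffLR (measurable_restrictT _ _)) => //.
    exact: measurable_funTS.
  - by move=> n x _; rewrite /g patchE; case: ifPn => //; rewrite lee_fin.
  - move=> x _ n m nm; rewrite /g !patchE lee_fin.
    case: ifPn => [/set_mem/= xn|_]; last by case: ifPn.
    rewrite mem_set//=; move: xn; rewrite !in_itv/= => /andP[nx xn].
    have nm' : n.+1%:R <= m.+1%:R :> R by rewrite ler_nat.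
    by rewrite (le_trans _ nx) ?lerN2//= (le_trans xn).
move=> cv; rewrite -(cvg_lim _ cv)//; apply: lime_le.
  by apply/cvg_ex; exists (\int[mu]_x (h x)%:E)%E.
by near=> n; rewrite gE.
Unshelve. all: by end_near. Qed.

End PowerIntegrals.

Local Notation ae_mono := (@filterS _ _ (ae_filter_ringOfSetsType lebesgue_measure) _ _ _).
Local Notation ae_mono2 := (@filterS2 _ _ (ae_filter_ringOfSetsType lebesgue_measure) _ _ _ _).
Local Notation ae_mono3 := (@filterS3 _ _ (ae_filter_ringOfSetsType lebesgue_measure) _ _ _ _ _).

Section IntegrableClosure.
Context {R : realType}.
Notation mu := (@lebesgue_measure R).
Variables (D : set R) (mD : measurable D).
Implicit Types f g : R -> R.

Lemma integrableRD f g : mu.-integrable D (EFin \o f) -> mu.-integrable D (EFin \o g) ->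
  mu.-integrable D (EFin \o (fun x => f x + g x)).
Proof. by move=> intf intg; exact: (@integrableD _ (measurableTypeR R) R mu D mD _ _ intf intg). Qed.

Lemma integrableRB f g : mu.-integrable D (EFin \o f) -> mu.-integrable D (EFin \o g) ->
  mu.-integrable D (EFin \o (fun x => f x - g x)).
Proof. by move=> intf intg; exact: (@integrableB _ (measurableTypeR R) R mu D mD _ _ intf intg). Qed.

Lemma integrableRZ (c : R) f : mu.-integrable D (EFin \o f) ->
  mu.-integrable D (EFin \o (fun x => c * f x)).
Proof. by move=> intf; exact: (@integrableZl _ (measurableTypeR R) R mu D mD c _ intf). Qed.

End IntegrableClosure.

Section Comparison.
Context {R : realType}.
Notation mu := (@lebesgue_measure R).
Implicit Types F h : R -> R.

Lemma abs_continuousZ F (c : R) a b : abs_continuous a b F ->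
  abs_continuous a b (fun x => c * F x).
Proof.
apply: (@abs_continuousM _ a b (cst c)).
by apply: (@abs_continuous_lip _ _ _ _ 0) => x y _ _ _; rewrite subrr normr0 mul0r.
Qed.

Lemma FTC_abs_le F h a b : (forall a b, abs_continuous a b F) -> a <= b ->
  mu.-integrable `[a, b] (EFin \o h) ->
  {ae mu, forall x, a <= x -> x <= b -> derivable F x 1 -> `|derive1 F x| <= h x} ->
  `|F b - F a| <= \int[mu]_(x in `[a, b]) h x.
Proof.
move=> acF ab ih hF.
have iNh : mu.-integrable `[a, b] (EFin \o (fun x => - h x)) by have := integrableN ih.
have Nh : \int[mu]_(x in `[a, b]) (- h x) = - \int[mu]_(x in `[a, b]) h x.
  by rewrite -mulN1r -RintegralZl//; apply: eq_Rintegral => x _; rewrite mulN1r.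
rewrite ler_norml; apply/andP; split.
  rewrite -Nh; apply: FTC_ge => //.
  by apply: (ae_mono hF) => x Fh ax xb dF; have := Fh ax xb dF; rewrite ler_norml => /andP[].
rewrite -lerN2 -Nh.
have -> : - (F b - F a) = -1 * F b - -1 * F a by ring.
apply: (@FTC_ge _ (fun x => -1 * F x) _ a b (fun c d => abs_continuousZ (-1) (acF c d)) ab iNh).
have [g [_ Hg _ _]] := abs_continuous_FTC acF.
apply: (ae_mono2 hF Hg) => x Fh [dF _] ax xb _.
rewrite (is_derive1_derive1 (is_derive1Z (-1) (derivable_is_derive1 dF))) mulN1r lerN2.
by have := Fh ax xb dF; rewrite ler_norml => /andP[].
Qed.

Lemma Rintegral_segment_le (h : R -> R) a b : (forall x, 0 <= h x) ->
  mu.-integrable setT (EFin \o h) ->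
  \int[mu]_(x in `[a, b]) h x <= \int[mu]_x h x.
Proof.
move=> h0 ih; have ihab : mu.-integrable `[a, b] (EFin \o h) by exact: integrableS ih.
apply: fine_le; rewrite ?(integrable_fin_num _ ihab)// ?(integrable_fin_num _ ih)//.
apply: ge0_subset_integral => //; first by have /integrableP[] := ih.
by move=> x _; rewrite lee_fin.
Qed.

End Comparison.

Section Continuity.
Context {R : realType}.
Implicit Types f g : R -> R.

Lemma continuous_mul f g : continuous f -> continuous g -> continuous (fun x => f x * g x).
Proof. by move=> cf cg x; apply: (@continuousM _ _ f g x); [exact: cf|exact: cg]. Qed.

Lemma continuous_add f g : continuous f -> continuous g -> continuous (fun x => f x + g x).
Proof. by move=> cf cg x; apply: (@continuousD _ _ _ f g x); [exact: cf|exact: cg]. Qed.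

Lemma continuous_scale (a : R) f : continuous f -> continuous (fun x => a * f x).
Proof. by move=> cf; apply: (@continuous_mul (cst a)) => // x; exact: cst_continuous. Qed.

Lemma continuous_opp f : continuous f -> continuous (fun x => - f x).
Proof. by move=> cf x; apply: (@continuousN _ _ _ f x); exact: cf. Qed.

End Continuity.

(** * The cutoff function and its first two derivatives *)

Section Cutoff.
Context {R : realType}.
Variable r : R.
Hypothesis r0 : 0 < r.
(** Chosen so that [s] vanishes at -2r and 2r. On [[-r, r]] then k x^2 <= 1/4, so [s] is at least
    3/4 and its cube at least 27/64. *)
Let k := (4 * r ^+ 2)^-1.
Let s (x : R) : R := 1 - k * x ^+ 2.

(* A cutoff supported in [-2r, 2r]; the cube makes it twice continuously differentiable. *)
Definition cut (x : R) : R := pospart (s x) ^+ 3.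
Definition cut' (x : R) : R := - (6 * k * x) * pospart (s x) ^+ 2.
Definition cut'' (x : R) : R := - (6 * k) * pospart (s x) ^+ 2 +
  24 * (k * (k * x ^+ 2)) * pospart (s x).

Let k0 : 0 < k. Proof. by rewrite invr_gt0 mulr_gt0// exprn_gt0. Qed.

Let ds (x : R) : is_derive x 1 s (- (2 * k * x)).
Proof.
have H : is_derive x 1 (fun t : R => t * t) (2 * x).
  apply: is_derive1_eqval (is_derive1M (is_derive_id x 1) (is_derive_id x 1)) _; ring.
have H' := is_derive1D (is_derive_cst (1 : R) x 1) (is_derive1Z (- k) H).
have -> : s = (fun t => cst 1 t + - k * (t * t)) by apply/funext => t; rewrite /s /=; ring.
by apply: is_derive1_eqval H' _; ring.
Qed.

Let k4 : 1 = k * (2 * r) ^+ 2.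
Proof. by rewrite /k; field; rewrite gt_eqF. Qed.

Let s_le1 x : s x <= 1.
Proof. by rewrite /s gerBl mulr_ge0 ?sqr_ge0// ltW. Qed.

Let m_le1 x : pospart (s x) <= 1.
Proof. by rewrite /pospart ge_max ler01 s_le1. Qed.

Let s_out (x : R) : ~ (- (2 * r) <= x <= 2 * r) -> pospart (s x) = 0.
Proof.
rewrite -ler_norml => /negP; rewrite -ltNge => rx; rewrite /pospart; apply/max_idPl.
rewrite /s {1}k4 -mulrBr pmulr_rle0// subr_le0 -(real_normK (num_real x)).
by rewrite ler_sqr ?nnegrE ?mulr_ge0// ltW.
Qed.

Let kx (x : R) : - (2 * r) <= x <= 2 * r -> k * x ^+ 2 <= 1.
Proof.
rewrite -ler_norml => xr; rewrite k4 ler_wpM2l ?(ltW k0)//.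
by rewrite -(real_normK (num_real x)) ler_sqr ?nnegrE// mulr_ge0// ltW.
Qed.

Lemma is_derive_cut (x : R) : is_derive x 1 cut (cut' x).
Proof.
apply: is_derive1_eqval (is_derive1_comp' (is_derive_pospart3 (s x)) (ds x)) _.
by rewrite /cut'; ring.
Qed.

Lemma is_derive_cut' (x : R) : is_derive x 1 cut' (cut'' x).
Proof.
have H1 := is_derive1Z (- (6 * k)) (is_derive_id x 1).
have H2 := is_derive1_comp' (is_derive_pospart2 (s x)) (ds x).
have -> : cut' = (fun t => (- (6 * k) * id t) * pospart (s t) ^+ 2).
  by apply/funext => t; rewrite /cut'/=; ring.
apply: is_derive1_eqval (is_derive1M H1 H2) _.
by rewrite /cut''/=; ring.
Qed.

Lemma continuous_cut'' : continuous cut''.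
Proof.
have cs : continuous (fun x => pospart (s x)).
  move=> x; apply: (@continuous_comp _ _ _ s pospart); last exact: continuous_pospart.
  exact: is_derive_continuous ds x.
have cx : continuous (fun x : R => x ^+ 2) by move=> x; exact: exprn_continuous.
apply: continuous_add.
  apply: continuous_scale => x.
  by apply: (@continuous_comp _ _ _ (fun x => pospart (s x)) (fun x => x ^+ 2));
    [exact: cs|exact: cx].
apply: continuous_mul => //; do 3 apply: continuous_scale; exact: cx.
Qed.

Lemma cut_ge0 x : 0 <= cut x.
Proof. by rewrite exprn_ge0// pospart_ge0. Qed.

Lemma cut_le1 x : cut x <= 1.
Proof. by rewrite exprn_ile1// pospart_ge0. Qed.

Lemma cut_out (x : R) : ~ (- (2 * r) <= x <= 2 * r) -> [/\ cut x = 0, cut' x = 0 & cut'' x = 0].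
Proof. by move=> /s_out sx; rewrite /cut /cut' /cut'' sx; split; ring. Qed.

Lemma cut_in (x : R) : - r <= x <= r -> 27 / 64 <= cut x.
Proof.
rewrite -ler_norml => xr.
have -> : 27 / 64 = (3 / 4) ^+ 3 :> R by field.
have sx : 3 / 4 <= s x.
  have : k * x ^+ 2 <= 1 / 4.
    have -> : 1 / 4 = k * r ^+ 2 by rewrite /k; field; rewrite gt_eqF.
    rewrite ler_wpM2l ?(ltW k0)//.
    by rewrite -(real_normK (num_real x)) ler_sqr ?nnegrE// ltW.
  by rewrite /s; lra.
rewrite /cut ler_pXn2r ?nnegrE ?pospart_ge0 ?divr_ge0//.
by rewrite /pospart le_max sx orbT.
Qed.

Lemma cut'_le x : `|cut' x| <= 3 / r.
Proof.
have [xr|xr] := pselect (- (2 * r) <= x <= 2 * r); last first.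
  by have [_ -> _] := cut_out xr; rewrite normr0 divr_ge0// ltW.
rewrite /cut' normrM normrN normrM (ger0_norm (ltW (mulr_gt0 _ k0)))//.
rewrite (ger0_norm (sqr_ge0 _)).
have -> : 3 / r = 6 * k * (2 * r) * 1 by rewrite /k; field; rewrite gt_eqF.
rewrite ler_pM ?mulr_ge0 ?sqr_ge0 ?pospart_ge0 ?(ltW k0)//.
  by rewrite ler_wpM2l ?mulr_ge0 ?(ltW k0)// ler_norml.
by rewrite exprn_ile1// pospart_ge0.
Qed.

Lemma cut''_le x : `|cut'' x| <= 8 / r ^+ 2.
Proof.
have [xr|xr] := pselect (- (2 * r) <= x <= 2 * r); last first.
  by have [_ _ ->] := cut_out xr; rewrite normr0 divr_ge0// sqr_ge0.
have -> : 8 / r ^+ 2 = 32 * k by rewrite /k; field; rewrite gt_eqF.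
have m0 := pospart_ge0 (s x); have m1 := m_le1 x; have kx1 := kx xr.
have kx0 : 0 <= k * x ^+ 2 by rewrite mulr_ge0 ?sqr_ge0// ltW.
rewrite /cut''; move: m0 m1 kx0 kx1; set m := pospart _; set y := k * x ^+ 2 => m0 m1 kx0 kx1.
have m2 : 0 <= m ^+ 2 <= 1 by rewrite sqr_ge0 exprn_ile1.
have ym : 0 <= y * m <= 1 by rewrite mulr_ge0// mulr_ile1.
have -> : - (6 * k) * m ^+ 2 + 24 * (k * y) * m = k * (24 * (y * m) - 6 * m ^+ 2) by ring.
rewrite normrM (gtr0_norm k0) [leRHS]mulrC ler_wpM2l ?(ltW k0)//.
move: m2 ym => /andP[a1 a2] /andP[a3 a4]; rewrite ler_norml; apply/andP; split; lra.
Qed.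

End Cutoff.

(** * Solutions of z'' = qz *)

Section Homogeneous.
Context {R : realType}.
Notation mu := (@lebesgue_measure R).
Variables (p : R) (q : R -> R).
Hypothesis hp : 1 < p.
Hypothesis hq : locally_integrable [set: R] q.
Hypothesis hq0 : {ae mu, forall x, 0 <= q x}.

Let p0 : 0 < p. Proof. exact: lt_trans hp. Qed.
Implicit Types (y z : R -> R) (x : R).

Lemma AC1_is_derive y : AC1_loc y -> forall x : R, is_derive x 1 y (derive1 y x).
Proof. by move=> [dy _] x; exact: derivable_is_derive1. Qed.

Lemma AC1_continuous_derive1 y : AC1_loc y -> continuous (derive1 y).
Proof. by move=> [_ acy]; apply: abs_continuous_continuous => a b; have [] := acy a b. Qed.

Lemma AC1_continuous y : AC1_loc y -> continuous y.
Proof. by move=> /AC1_is_derive; exact: is_derive_continuous. Qed.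

Lemma AC1_ae_derivable y : AC1_loc y ->
  {ae mu, forall x : R, is_derive x 1 (derive1 y) (derive1n 2 y x)}.
Proof.
move=> [_ acy]; have [g [_ Hg _ _]] := abs_continuous_FTC (fun a b => (acy a b).2).
by apply: (ae_mono Hg) => x [dx _]; exact: derivable_is_derive1.
Qed.

Lemma AC1_measurable y : AC1_loc y ->
  exists2 g : R -> R, measurable_fun setT g & {ae mu, forall x, derive1n 2 y x = g x}.
Proof.
move=> [_ acy]; have [g [mg Hg _ _]] := abs_continuous_FTC (fun a b => (acy a b).2).
by exists g => //; apply: (ae_mono Hg) => x [].
Qed.

(** A continuous derivative is bounded on segments, so y is Lipschitz there and absolute continuity
    need only be checked for [dy]. *)
Lemma AC1_intro y dy (ddy : R -> R) : (forall x : R, is_derive x 1 y (dy x)) ->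
  (forall a b, abs_continuous a b dy) ->
  {ae mu, forall x : R, is_derive x 1 dy (ddy x)} ->
  AC1_loc y /\ {ae mu, forall x, derive1n 2 y x = ddy x}.
Proof.
move=> dyE acdy ddyE.
have E : derive1 y = dy by apply/funext => x; exact: is_derive1_derive1.
split; last by apply: (ae_mono ddyE) => x; rewrite /derive1n/= E; exact: is_derive1_derive1.
split => [x|a b]; first exact: (@ex_derive _ _ _ _ _ _ _ (dyE x)).
rewrite E; split => //; apply: C1_abs_continuous dyE _ a b.
exact: abs_continuous_continuous.
Qed.

Lemma AC1_B y1 y2 : AC1_loc y1 -> AC1_loc y2 ->
  AC1_loc (fun x => y1 x - y2 x) /\
  {ae mu, forall x, derive1n 2 (fun x => y1 x - y2 x) x = derive1n 2 y1 x - derive1n 2 y2 x}.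
Proof.
move=> ac1 ac2; apply: (@AC1_intro _ (fun x => derive1 y1 x - derive1 y2 x)).
- by move=> x; apply: is_deriveB; exact: AC1_is_derive.
- move=> a b; have [_ /(_ a b)[_ a1]] := ac1; have [_ /(_ a b)[_ a2]] := ac2.
  have -> : (fun x => derive1 y1 x - derive1 y2 x) =
      derive1 y1 \+ (fun x => cst (-1) x * derive1 y2 x).
    by apply/funext => x /=; rewrite mulN1r.
  apply: abs_continuousD => //; apply: abs_continuousM => //.
  by apply: (@abs_continuous_lip _ _ _ _ 0) => x y _ _ _; rewrite subrr normr0 mul0r.
- apply: (ae_mono2 (AC1_ae_derivable ac1) (AC1_ae_derivable ac2)) => x d1 d2.
  exact: is_deriveB.
Qed.

Definition homogeneous z := AC1_loc z /\ {ae mu, forall x, derive1n 2 z x = q x * z x}.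

Lemma homogeneous_ae z : homogeneous z ->
  {ae mu, forall x : R, 0 <= q x /\ is_derive x 1 (derive1 z) (q x * z x)}.
Proof.
move=> [acz zE]; apply: (ae_mono3 hq0 zE (AC1_ae_derivable acz)) => x q0 E dz.
by split; [exact: q0|exact: is_derive1_eqval dz E].
Qed.

Lemma continuous_support_in_Lp f a b : a <= b -> continuous f ->
  (forall x : R, ~ (a <= x <= b) -> f x = 0) -> in_Lp p f.
Proof.
move=> ab cf f0; have mf := continuous_measurable_fun cf.
apply/in_LpE; split => //; rewrite Lp_norm_lty ?gt_eqF//.
have [M M0 HM] := bounded_on_segment a b cf.
apply: le_lt_trans (_ : ((M `^ p * (b - a))%:E < +oo)%E); last by rewrite ltry.
apply: pint_support => // x; have [xab|xab] := pselect (a <= x <= b); last first.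
  by rewrite f0// normr0.
by apply: HM; move/andP: xab => [].
Qed.

Lemma solution0_unique z : correctly_solvable p q -> homogeneous z -> in_Lp p z ->
  z = cst 0.
Proof.
move=> [exu _] [acz zE] zp.
have c0 : continuous (cst 0 : R -> R) by move=> x; exact: cst_continuous.
have L0 : in_Lp p (cst 0) by exact: (@continuous_support_in_Lp _ 0 0).
have [ac0 E0] : AC1_loc (cst 0 : R -> R) /\ {ae mu, forall x, derive1n 2 (cst 0) x = 0 :> R}.
  have d0 (x : R) : is_derive x 1 (cst 0 : R -> R) (cst 0 x) by exact: is_derive_cst.
  have H : {ae mu, forall x : R, is_derive x 1 (cst 0 : R -> R) (cst 0 x)} by exact: aeW.
  have ac a b : abs_continuous a b (cst 0 : R -> R).
    by apply: (@abs_continuous_lip _ _ _ _ 0) => x y _ _ _; rewrite subrr normr0 mul0r.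
  exact: (AC1_intro d0 ac H).
have [y [_ yu]] := exu (cst 0) L0.
rewrite -(yu z); first apply: yu.
- split => //; split => //; apply: (ae_mono E0) => x ->; by rewrite /= oppr0 mulr0 addr0.
- split => //; split => //; apply: (ae_mono zE) => x ->; by rewrite addNr.
Qed.

(* Multiplying z by a cutoff at scale r turns it into a compactly supported solution for the
   right-hand side -2z'phi'-z phi'', whose L_p norm stays bounded as r grows. *)
Lemma homogeneous_growth z C : homogeneous z ->
  (forall r x, 1 <= r -> - (2 * r) <= x <= 2 * r -> `|derive1 z x| <= C * r `^ (1 - p^-1)) ->
  correctly_solvable p q -> z = cst 0.
Proof.
move=> hz G hsolv; have [acz _] := hz.
apply: solution0_unique => //.
have [_ [c c0 II]] := hsolv.
have C0 : 0 <= C.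
  have H0 : - (2 * 1) <= (0 : R) <= 2 * 1 by apply/andP; split; lra.
  by have := G 1 0 (lexx _) H0; rewrite powR1 mulr1; exact: le_trans.
have dz := AC1_is_derive acz; have cz := AC1_continuous acz.
have cu := AC1_continuous_derive1 acz; have mz := continuous_measurable_fun cz.
set u := derive1 z in dz cu G.
have acu a b : abs_continuous a b u by have [_ /(_ a b)[]] := acz.
have acz0 a b : abs_continuous a b z by have [_ /(_ a b)[]] := acz.
set al := 1 - p^-1 in G.
have al0 : 0 <= al by rewrite /al subr_ge0 invf_le1 // ltW.
(* The bound on z' is applied between 0 and x with |x| <= 2r; the constant |z(0)| is absorbed
   because r r^al >= 1. *)
pose A := `|z 0| + 2 * C.
have A0 : 0 <= A by rewrite addr_ge0// mulr_ge0.
have zA r x : 1 <= r -> - (2 * r) <= x <= 2 * r -> `|z x| <= A * (r * r `^ al).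
  move=> r1 xr; have r0 : 0 < r := lt_le_trans ltr01 r1.
  have rr1 : 1 <= r * r `^ al.
    by rewrite mulr_ege1// -(powRr0 r) ler_powR.
  have zx : `|z x - z 0| <= C * r `^ al * (2 * r).
    move: (xr) => /andP[rx xr2].
    have [x0|x0] := leP 0 x.
      have [d [d0 dx] ->] := C1_mean_value dz x0.
      rewrite subr0 normrM ler_pM//; last by rewrite ger0_norm.
      by apply: G => //; apply/andP; split; lra.
    have [d [d0 dx] E] := C1_mean_value dz (ltW x0).
    rewrite distrC E normrM ler_pM//; last by rewrite ger0_norm; lra.
    by apply: G => //; apply/andP; split; lra.
  have -> : z x = (z x - z 0) + z 0 by ring.
  rewrite (le_trans (ler_normD _ _))// /A mulrDl addrC lerD//.
    by rewrite ler_peMr.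
  by apply: le_trans zx _; rewrite le_eqVlt; apply/orP; left; apply/eqP; ring.
(* The bounds 3 / r on [cut'] and 8 / r^2 on [cut''] contribute 2 times 3 C and 8 A. The right-hand
   side is then at most B r^(-1/p), and its p-th power integrates over length 4r to at most 4 B^p,
   whatever r. *)
pose B := 6 * C + 8 * A; have B0 : 0 <= B by rewrite addr_ge0// mulr_ge0.
have pY r : 1 <= r -> (pint p (fun x => (z x * cut r x)%R) <= (c `^ p * (B `^ p * 4))%:E)%E.
  move=> r1; have r0 : 0 < r := lt_le_trans ltr01 r1.
  have dcut := is_derive_cut r; have dcut' := is_derive_cut' r.
  have ccut := is_derive_continuous dcut; have ccut' := is_derive_continuous dcut'.
  have ccut'' := @continuous_cut'' _ r.
  pose f x := - (2 * (u x * cut' r x) + z x * cut'' r x).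
  have cf : continuous f.
    apply: continuous_opp; apply: continuous_add; last exact: continuous_mul.
    by apply: (@continuous_scale _ 2); exact: continuous_mul.
  have f0 x : ~ (- (2 * r) <= x <= 2 * r) -> f x = 0.
    by move=> /(cut_out r0)[_ E1 E2]; rewrite /f E1 E2; ring.
  have rr : - (2 * r) <= 2 * r by lra.
  have Lf : in_Lp p f := continuous_support_in_Lp rr cf f0.
  have cY : continuous (fun x => z x * cut r x).
    exact: continuous_mul.
  have LY : in_Lp p (fun x => z x * cut r x).
    apply: continuous_support_in_Lp rr cY _ => x.
    by move=> /(cut_out r0)[-> _ _]; rewrite mulr0.
  have acdY a b : abs_continuous a b (fun x => u x * cut r x + z x * cut' r x).
    apply: abs_continuousD; apply: abs_continuousM => //.
      exact: C1_abs_continuous dcut ccut' a b.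
    exact: C1_abs_continuous dcut' ccut'' a b.
  have ddY : {ae mu, forall x : R,
      is_derive x 1 (fun x => u x * cut r x + z x * cut' r x)
        ((q x * z x * cut r x + u x * cut' r x) + (u x * cut' r x + z x * cut'' r x))}.
    apply: (ae_mono (homogeneous_ae hz)) => x [_ dux].
    exact: is_derive1D (is_derive1M dux (dcut x)) (is_derive1M (dz x) (dcut' x)).
  have [acY YE] := AC1_intro (fun x => is_derive1M (dz x) (dcut x)) acdY ddY.
  have sY : solution q f (fun x => z x * cut r x).
    by split => //; apply: (ae_mono YE) => x ->; rewrite /f; ring.
  have := pint_le_norm p0 (ltW c0) (II _ _ Lf sY LY); move/le_trans; apply.
  rewrite [leRHS]EFinM lee_wpmul2l ?lee_fin ?powR_ge0//.
  have fM x : `|f x| <= B * r `^ (- p^-1).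
    have [xr|xr] := pselect (- (2 * r) <= x <= 2 * r); last first.
      by rewrite (f0 x xr) normr0 mulr_ge0// powR_ge0.
    have -> : r `^ (- p^-1) = r `^ al / r.
      have -> : - p^-1 = al - 1 by rewrite /al; ring.
      rewrite powRB; last by rewrite (lt0r_neq0 r0) implybT.
      by rewrite powRr1// ltW.
    have h1 := G r x r1 xr; have h2 := zA r x r1 xr.
    have h3 := cut'_le r0 x; have h4 := cut''_le r0 x.
    rewrite /f; move: (cut' r x) (cut'' r x) h3 h4 => c1 c2 h3 h4.
    rewrite normrN (le_trans (ler_normD _ _))// normrM (normr_nat _ 2) !normrM.
    have -> : B * (r `^ al / r) = 2 * (C * r `^ al * (3 / r)) + A * (r * r `^ al) * (8 / r ^+ 2).
      by rewrite /B; field; rewrite gt_eqF.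
    by rewrite lerD// ?ler_wpM2l// ler_pM.
  apply: le_trans (pint_support p0 rr (continuous_measurable_fun cf) fM f0) _.
  rewrite lee_fin powRM ?powR_ge0// -powRrM mulNr mulVf ?gt_eqF// powRN powRr1 ?(ltW r0)//.
  rewrite le_eqVlt; apply/orP; left; apply/eqP; field; by rewrite gt_eqF.
(* On [[-r, r]] the cutoff is at least 27/64, so the bound for z times the cutoff passes to z there,
   uniformly in r, and then to the line. *)
pose a := (27 / 64 : R) `^ p.
have a0 : 0 < a by rewrite powR_gt0// divr_gt0.
apply/in_LpE; split => //; rewrite Lp_norm_lty ?gt_eqF//.
apply: le_lt_trans (_ : ((a^-1 * (c `^ p * (B `^ p * 4)))%:E < +oo)%E); last by rewrite ltry.
apply: ge0_integral_exhaust; [exact: measurable_powR_norm|by move=> x; exact: powR_ge0|].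
move=> n; set r : R := n.+1%:R.
have r1 : 1 <= r by rewrite ler1n.
have r0 : 0 < r := lt_le_trans ltr01 r1.
have mY : measurable_fun setT (fun x => z x * cut r x).
  apply: measurable_funM => //; apply: continuous_measurable_fun.
  exact: is_derive_continuous (is_derive_cut r).
apply: (@le_trans _ _ (\int[mu]_(x in `[(- r)%R, r]) (a^-1%:E * (`|z x * cut r x| `^ p)%:E))%E).
  apply: ge0_le_integral => //.
  - by apply/measurable_EFinP; apply: measurable_powR_norm; exact: measurable_funTS.
  - apply: measurable_funTS; apply/measurable_EFinP; apply: measurable_funM => //.
    exact: measurable_powR_norm.
  - move=> x; rewrite /= in_itv/= => xr; rewrite -EFinM lee_fin.
    rewrite ler_pdivlMl// -powRM ?divr_ge0// ge0_ler_powR ?nnegrE ?mulr_ge0 ?divr_ge0//.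
      exact: ltW.
    by rewrite normrM mulrC ler_wpM2l// (le_trans (cut_in r0 xr))// ler_norm.
rewrite ge0_integralZl//; last 2 first.
- apply: measurable_funTS; apply/measurable_EFinP; exact: measurable_powR_norm.
- by rewrite lee_fin invr_ge0 ltW.
rewrite [leRHS]EFinM lee_wpmul2l ?lee_fin ?invr_ge0 ?(ltW a0)//.
apply: le_trans (pY r r1); apply: ge0_subset_integral => //.
by apply/measurable_EFinP; exact: measurable_powR_norm.
Qed.

(** Almost everywhere (z z')' = z'^2 + q z^2 >= 0 and (z'^2)' = 2 q z z', which give the
    monotonicity that [bounded_line] asks for. Where |z| >= 1, |z''| = q |z| <= q |z|^p, so the
    integral of q |z|^p bounds the increments of z'. *)
Lemma homogeneous_bounded z : homogeneous z ->
  mu.-integrable setT (EFin \o (fun x => `|q x| * `|z x| `^ p)) ->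
  exists M : R, forall x, `|derive1 z x| <= M.
Proof.
move=> hz iQ; have [acz zE] := hz; have [_ acz'] := acz.
have acu a b : abs_continuous a b (derive1 z) by have [] := acz' a b.
have acz0 a b : abs_continuous a b z by have [] := acz' a b.
have dz := AC1_is_derive acz; have aez := homogeneous_ae hz.
pose Q x := `|q x| * `|z x| `^ p.
have Q0 x : 0 <= Q x by rewrite mulr_ge0// powR_ge0.
have iQab a b : mu.-integrable `[a, b] (EFin \o Q) by exact: integrableS iQ.
pose K := \int[mu]_x Q x.
have QK a b : \int[mu]_(x in `[a, b]) Q x <= K.
  exact: Rintegral_segment_le.
apply: (@bounded_line _ z (derive1 z) K dz (AC1_continuous_derive1 acz)).
- move=> a b ab; apply: (@ae_derive1_nondecreasing _ (fun x => z x * derive1 z x)) => //.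
    by move=> c d; exact: abs_continuousM.
  apply: (ae_mono aez) => x [q0 du] _ _ _.
  rewrite (is_derive1_derive1 (is_derive1M (dz x) du)).
  by rewrite addr_ge0// -?expr2 ?sqr_ge0// mulrCA mulr_ge0// -expr2 sqr_ge0.
- move=> a b ab w0.
  suff : -1 * (derive1 z a * derive1 z a) <= -1 * (derive1 z b * derive1 z b).
    by rewrite !mulN1r lerN2 -!expr2.
  apply: (@ae_derive1_nondecreasing _ (fun x => -1 * (derive1 z x * derive1 z x))) => //.
    by move=> c d; apply: abs_continuousZ; exact: abs_continuousM.
  apply: (ae_mono aez) => x [q0 du] ax xb _.
  rewrite (is_derive1_derive1 (is_derive1Z (-1) (is_derive1M du du))).
  have -> : -1 * (q x * z x * derive1 z x + derive1 z x * (q x * z x)) =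
    q x * (2 * - (z x * derive1 z x)) by ring.
  by rewrite mulr_ge0// mulr_ge0// oppr_ge0 w0.
- move=> a b ab w0; rewrite !expr2.
  apply: (@ae_derive1_nondecreasing _ (fun x => derive1 z x * derive1 z x)) => //.
    by move=> c d; exact: abs_continuousM.
  apply: (ae_mono aez) => x [q0 du] ax xb _.
  rewrite (is_derive1_derive1 (is_derive1M du du)).
  have -> : q x * z x * derive1 z x + derive1 z x * (q x * z x) =
    q x * (2 * (z x * derive1 z x)) by ring.
  by rewrite mulr_ge0// mulr_ge0// w0.
- move=> a b ab z1.
  have zQ x : a <= x -> x <= b -> 0 <= q x -> `|q x * z x| <= Q x.
    move=> ax xb q0; rewrite normrM /Q ler_wpM2l//.
    by rewrite le1r_powR ?z1// ltW.
  apply: le_trans (QK a b); apply: FTC_abs_le => //.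
  by apply: (ae_mono aez) => x [q0 du] ax xb _; rewrite (is_derive1_derive1 du) zQ.
Qed.

(** A pointwise substitute for Hölder's inequality: integrated over a length of order r, both terms
    are of order r^(1-1/p). If g exceeds r^(-1/p), then r^(1-1/p) g^(p-1) >= 1 and the first term
    alone suffices. *)
Lemma le_powR_split r g : 0 < r -> 0 <= g ->
  g <= r `^ (1 - p^-1) * g `^ p + r `^ (- p^-1).
Proof.
move=> r0 g0; have [gr|rg] := leP g (r `^ (- p^-1)).
  by rewrite ler_wpDl// mulr_ge0// powR_ge0.
rewrite ler_wpDr ?powR_ge0//.
rewrite -[g `^ p]mulr_powRB1// mulrCA ler_peMr//.
have E : r `^ (1 - p^-1) * r `^ (- p^-1) `^ (p - 1) = 1.
  rewrite -powRrM -powRD; last by rewrite (lt0r_neq0 r0) implybT.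
  have -> : 1 - p^-1 + - p^-1 * (p - 1) = 0 by field; rewrite gt_eqF.
  by rewrite powRr0.
rewrite -[leLHS]E ler_wpM2l ?powR_ge0// ge0_ler_powR ?nnegrE ?powR_ge0// ?subr_ge0 ltW//.
Qed.

Lemma homogeneous_second_derivative_growth z : homogeneous z ->
  mu.-integrable setT (EFin \o (fun x => `|q x * z x| `^ p)) ->
  exists C : R, forall r x, 1 <= r -> - (2 * r) <= x <= 2 * r ->
    `|derive1 z x| <= C * r `^ (1 - p^-1).
Proof.
move=> hz iG; have [acz _] := hz; have [_ acz'] := acz.
have acu a b : abs_continuous a b (derive1 z) by have [] := acz' a b.
have aez := homogeneous_ae hz.
pose G x := `|q x * z x| `^ p; pose K := \int[mu]_x G x.
have iGab a b : mu.-integrable `[a, b] (EFin \o G) by exact: integrableS iG.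
have GK a b : \int[mu]_(x in `[a, b]) G x <= K.
  by apply: Rintegral_segment_le => // x; exact: powR_ge0.
(* K comes from the integral of |qz|^p, and 2 from r^(-1/p) integrated over a length of at most
   2r. *)
exists (`|derive1 z 0| + K + 2) => r x r1 xr.
have r0 : 0 < r := lt_le_trans ltr01 r1.
set al := 1 - p^-1.
have al0 : 0 <= al by rewrite /al subr_ge0 invf_le1 // ltW.
have ral : 1 <= r `^ al by rewrite -(powRr0 r) ler_powR.
have rE : r `^ (- p^-1) * r = r `^ al.
  rewrite -{2}(powRr1 (ltW r0)) -powRD; last by rewrite (lt0r_neq0 r0) implybT.
  by rewrite addrC.
have var a b : a <= b -> b - a <= 2 * r -> `|derive1 z b - derive1 z a| <= (K + 2) * r `^ al.
  move=> ab bar.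
  have ic (c : R) : mu.-integrable `[a, b] (EFin \o (cst c : R -> R)).
    by apply: continuous_integrable_segment => y; exact: cst_continuous.
  have iZ : mu.-integrable `[a, b] (EFin \o (fun x => r `^ al * G x)).
    exact: integrableRZ.
  have ih : mu.-integrable `[a, b] (EFin \o (fun x => r `^ al * G x + cst (r `^ (- p^-1)) x)).
    exact: integrableRD.
  apply: le_trans (FTC_abs_le acu ab ih _) _.
    apply: (ae_mono aez) => y [q0 du] _ _ _; rewrite (is_derive1_derive1 du).
    exact: le_powR_split.
  rewrite RintegralD// RintegralZl// Rintegral_cst//= mulrDl lerD//.
    by rewrite mulrC ler_wpM2r ?powR_ge0.
  have -> : fine (mu `[a, b]%classic) = b - a.
    rewrite lebesgue_measure_itv/= lte_fin; case: ifPn => //.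
    by rewrite -leNgt => ba; have -> : a = b; [apply/eqP; rewrite eq_le ab|rewrite subrr].
  rewrite -rE mulrCA ler_wpM2l ?powR_ge0//.
have u0 : `|derive1 z x - derive1 z 0| <= (K + 2) * r `^ al.
  move: xr => /andP[rx xr]; have [x0|x0] := leP 0 x; first by apply: var => //; lra.
  by rewrite distrC; apply: var; lra.
have -> : derive1 z x = (derive1 z x - derive1 z 0) + derive1 z 0 by ring.
have h : `|derive1 z 0| <= `|derive1 z 0| * r `^ al by rewrite ler_peMr.
rewrite (le_trans (ler_normD _ _))//.
have -> : (`|derive1 z 0| + K + 2) * r `^ al = (K + 2) * r `^ al + `|derive1 z 0| * r `^ al by ring.
exact: lerD.
Qed.

End Homogeneous.

(** * The energy estimate *)

Section Energy.
Context {R : realType}.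
Notation mu := (@lebesgue_measure R).
Variable p : R.
Hypothesis hp : 1 < p.
Implicit Types (e x : R) (y : R -> R).

Let p0 : 0 < p. Proof. exact: lt_trans hp. Qed.

Lemma is_derive1B (f g : R -> R) x df dg : is_derive x 1 f df -> is_derive x 1 g dg ->
  is_derive x 1 (fun t => f t - g t) (df - dg).
Proof. by move=> fx gx; apply: is_deriveB. Qed.

(** A smooth positive substitute for |s|: all its real powers are differentiable, whereas |s|^(p-2)
    s is not differentiable at 0 for p < 2. *)
Definition regabs e (s : R) : R := Num.sqrt (s ^+ 2 + e ^+ 2).

(** * Inequalities and derivatives for the regularised absolute value *)

Section regabs.
Variable e : R.
Hypothesis e0 : 0 < e.

Let arg0 s : 0 < s ^+ 2 + e ^+ 2.
Proof. by rewrite ltr_wpDl ?sqr_ge0// exprn_gt0. Qed.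

Lemma regabs_gt0 s : 0 < regabs e s.
Proof. by rewrite sqrtr_gt0. Qed.

Lemma regabs_sqr s : regabs e s ^+ 2 = s ^+ 2 + e ^+ 2.
Proof. by rewrite sqr_sqrtr// ltW. Qed.

Lemma norm_le_regabs s : `|s| <= regabs e s.
Proof.
rewrite -(@ler_pXn2r _ 2) ?nnegrE ?(ltW (regabs_gt0 s))//.
by rewrite real_normK ?num_real// regabs_sqr lerDl sqr_ge0.
Qed.

Lemma regabs_powR_le s : regabs e s `^ p <= 2 `^ p * (`|s| `^ p + e `^ p).
Proof.
have [se|es] := leP `|s| e.
  apply: (@le_trans _ _ ((2 * e) `^ p)).
    rewrite ge0_ler_powR ?nnegrE ?(ltW p0) ?(ltW (regabs_gt0 s)) ?mulr_ge0 ?(ltW e0)//.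
    rewrite -(@ler_pXn2r _ 2) ?nnegrE ?(ltW (regabs_gt0 s)) ?mulr_ge0 ?(ltW e0)//.
    rewrite regabs_sqr -(real_normK (num_real s)).
    by have := normr_ge0 s; nra.
  by rewrite powRM ?(ltW e0)// ler_wpM2l ?powR_ge0// lerDr powR_ge0.
apply: (@le_trans _ _ ((2 * `|s|) `^ p)).
  rewrite ge0_ler_powR ?nnegrE ?(ltW p0) ?(ltW (regabs_gt0 s)) ?mulr_ge0//.
  rewrite -(@ler_pXn2r _ 2) ?nnegrE ?(ltW (regabs_gt0 s)) ?mulr_ge0//.
  rewrite regabs_sqr -(real_normK (num_real s)) exprMn.
  have : e ^+ 2 <= `|s| ^+ 2 by rewrite ler_pXn2r ?nnegrE ?(ltW e0)// ltW.
  by have := sqr_ge0 `|s|; lra.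
by rewrite powRM// ler_wpM2l ?powR_ge0// lerDl powR_ge0.
Qed.

Lemma powR_regabs_split s : regabs e s `^ p = regabs e s ^+ 2 * regabs e s `^ (p - 2).
Proof.
rewrite -(powR_mulrn 2 (ltW (regabs_gt0 s))) -powRD.
  by congr (_ `^ _); ring.
by rewrite (lt0r_neq0 (regabs_gt0 s)) implybT.
Qed.

(** Bounds from below the term multiplied by q in the tested equation. For |s| > e the square of
    [regabs e s] is at most 2 s^2; for |s| <= e the term e^p suffices. *)
Lemma norm_powR_le_regabs s :
  `|s| `^ p <= 2 * (s ^+ 2 * regabs e s `^ (p - 2)) + e `^ p.
Proof.
have T0 : 0 <= s ^+ 2 * regabs e s `^ (p - 2) by rewrite mulr_ge0 ?sqr_ge0 ?powR_ge0.
have [se|es] := leP `|s| e.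
  apply: (@le_trans _ _ (e `^ p)); last by rewrite lerDr mulr_ge0.
  by rewrite ge0_ler_powR ?nnegrE ?(ltW p0) ?(ltW e0).
rewrite ler_wpDr ?powR_ge0//.
apply: (@le_trans _ _ (regabs e s `^ p)).
  rewrite ge0_ler_powR ?nnegrE ?(ltW p0) ?(ltW (regabs_gt0 s)) ?norm_le_regabs//.
rewrite powR_regabs_split mulrA ler_wpM2r ?powR_ge0// regabs_sqr -(real_normK (num_real s)).
have : e ^+ 2 <= `|s| ^+ 2 by rewrite ler_pXn2r ?nnegrE ?(ltW e0)// ltW.
lra.
Qed.

(** A crude Young inequality: the larger of [regabs e s] and b dominates. When b is larger, |s|
    t^(p-2) is first raised to t^(p-1), because p - 2 may be negative. *)
Lemma regabs_young s b : 0 <= b ->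
  `|s| * regabs e s `^ (p - 2) * b <= regabs e s `^ p + b `^ p.
Proof.
move=> b0; set t := regabs e s; have t0 : 0 < t := regabs_gt0 s.
have st : `|s| <= t := norm_le_regabs s.
have [bt|tb] := leP b t.
  rewrite ler_wpDr ?powR_ge0// powR_regabs_split -/t expr2.
  have -> : `|s| * t `^ (p - 2) * b = `|s| * b * t `^ (p - 2) by ring.
  by rewrite ler_wpM2r ?powR_ge0// ler_pM.
rewrite ler_wpDl ?powR_ge0// -(mulr_powRB1 b0 p0) mulrC ler_wpM2l//.
apply: (@le_trans _ _ (t * t `^ (p - 2))); first by rewrite ler_wpM2r ?powR_ge0.
rewrite -{1}(powRr1 (ltW t0)) -powRD; last by rewrite (lt0r_neq0 t0) implybT.
have -> : 1 + (p - 2) = p - 1 by ring.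
by rewrite ge0_ler_powR ?nnegrE ?(ltW t0) ?subr_ge0// ltW.
Qed.

Lemma is_derive_regabs y (u : R -> R) x : is_derive x 1 y (u x) ->
  is_derive x 1 (fun t => regabs e (y t)) (y x * u x / regabs e (y x)).
Proof.
move=> dy.
have d2 : is_derive x 1 (fun t => y t * y t + e ^+ 2) (y x * u x * 2).
  apply: is_derive1_eqval (is_derive1D (is_derive1M dy dy) (is_derive_cst (e ^+ 2) x 1)) _.
  by rewrite addr0; ring.
have -> : (fun t => regabs e (y t)) = (fun t => Num.sqrt (y t * y t + e ^+ 2)).
  by apply/funext => t; rewrite /regabs expr2.
have H : 0 < y x * y x + e ^+ 2 by rewrite -expr2.
apply: is_derive1_eqval (@is_derive1_comp' _ Num.sqrt (fun t => y t * y t + e ^+ 2) x _ _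
  (is_derive1_sqrt H) d2) _.
rewrite /regabs (expr2 (y x)); field.
by rewrite gt_eqF// sqrtr_gt0.
Qed.

Lemma is_derive_regabs_powR y (u : R -> R) a x : is_derive x 1 y (u x) ->
  is_derive x 1 (fun t => regabs e (y t) `^ a)
    (a * regabs e (y x) `^ (a - 1) * (y x * u x / regabs e (y x))).
Proof.
move=> dy.
exact: (@is_derive1_comp' _ (fun s => s `^ a) (fun t => regabs e (y t)) x _ _
  (is_derive1_powR a (regabs_gt0 (y x))) (is_derive_regabs dy)).
Qed.

End regabs.

Lemma integrable_cut_energy q y r : 0 < r ->
  mu.-integrable `[(- (2 * r))%R, (2 * r)%R] (EFin \o q) -> continuous y ->
  mu.-integrable `[(- (2 * r))%R, (2 * r)%R]
    (EFin \o (fun x => 2^-1 * (`|q x| * (cut r x * `|y x| `^ p)))).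
Proof.
move=> r0 iq cy.
have iaq : mu.-integrable `[(- (2 * r))%R, (2 * r)%R] (EFin \o (fun x => `|q x|)).
  exact: (integrable_norm iq).
have ccut := is_derive_continuous (is_derive_cut r).
have mq : measurable_fun `[(- (2 * r))%R, (2 * r)%R] q.
  by have /integrableP[/measurable_EFinP] := iq.
have [M M0 HM] := bounded_on_segment (- (2 * r)) (2 * r) cy.
apply: integrableRZ => //.
apply: (@le_integrableR _ _ _ (fun x => M `^ p * `|q x|)) => //; last exact: integrableRZ.
  apply: measurable_funM; first exact: measurableT_comp.
  apply: measurable_funM.
    by apply: measurable_funTS; exact: continuous_measurable_fun.
  apply: measurable_powR_norm.
  by apply: measurable_funTS; exact: continuous_measurable_fun.
move=> x; rewrite /= in_itv/= => /andP[rx xr].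
have hp0 : 0 <= cut r x * `|y x| `^ p := mulr_ge0 (cut_ge0 r x) (powR_ge0 _ _).
rewrite (ger0_norm (mulr_ge0 (normr_ge0 _) hp0)).
rewrite (ger0_norm (mulr_ge0 (powR_ge0 _ _) (normr_ge0 _))) mulrC ler_wpM2r//.
apply: (@le_trans _ _ (1 * `|y x| `^ p)); first exact: ler_wpM2r (powR_ge0 _ _) _ _ (cut_le1 r0 x).
by rewrite mul1r ge0_ler_powR ?nnegrE ?(ltW p0)// HM.
Qed.

(* Testing the equation against cut r * T(y), where T is the derivative of the smooth convex
   function Phi(s) = (s^2 + e^2)^(p/2) / p, a regularisation of |s|^p / p. Convexity gives the
   sign of the first-order term, so only the cutoff's second derivative remains. *)
Lemma energy_local q f y r e : {ae mu, forall x, 0 <= q x} ->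
  solution q f y -> 1 <= r -> 0 < e ->
  mu.-integrable `[(- (2 * r))%R, (2 * r)%R] (EFin \o q) ->
  mu.-integrable `[(- (2 * r))%R, (2 * r)%R] (EFin \o (fun x => `|f x| `^ p)) ->
  mu.-integrable `[(- (2 * r))%R, (2 * r)%R] (EFin \o (fun x => `|y x| `^ p)) ->
  \int[mu]_(x in `[(- (2 * r))%R, (2 * r)%R]) (2^-1 * (`|q x| * (cut r x * `|y x| `^ p))) <=
  \int[mu]_(x in `[(- (2 * r))%R, (2 * r)%R])
    (`|f x| `^ p + 9 * 2 `^ p * `|y x| `^ p + e `^ p * (2^-1 * `|q x| + 9 * 2 `^ p)).
Proof.
move=> q0 [acy yf] r1 e0 iq iF iY.
have r0 : 0 < r := lt_le_trans ltr01 r1.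
have rr : - (2 * r) <= 2 * r by lra.
have dy := AC1_is_derive acy; set u := derive1 y in dy.
have cy := AC1_continuous acy; have cu := AC1_continuous_derive1 acy.
have acu a b : abs_continuous a b u by have [_ /(_ a b)[]] := acy.
pose t x := regabs e (y x).
have t0 x : 0 < t x := regabs_gt0 e0 (y x).
have dta a x : is_derive x 1 (fun s => t s `^ a) (a * t x `^ (a - 1) * (y x * u x / t x)).
  exact: (is_derive_regabs_powR e0 a (dy x)).
have cta a : continuous (fun s => t s `^ a) := is_derive_continuous (dta a).
pose Phi x := p^-1 * t x `^ p; pose T x := y x * t x `^ (p - 2).
pose dT x := u x * t x `^ (p - 2) + y x * ((p - 2) * t x `^ (p - 2 - 1) * (y x * u x / t x)).
have dTE (x : R) : is_derive x 1 T (dT x) := is_derive1M (dy x) (dta (p - 2) x).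
have dPhi (x : R) : is_derive x 1 Phi (T x * u x).
  apply: is_derive1_eqval (is_derive1Z p^-1 (dta p x)) _.
  have -> : t x `^ (p - 1) = t x * t x `^ (p - 2).
    rewrite -{2}(powRr1 (ltW (t0 x))) -powRD; last by rewrite (lt0r_neq0 (t0 x)) implybT.
    by congr (_ `^ _); ring.
  by rewrite /T; field; rewrite !gt_eqF.
have cT : continuous T := is_derive_continuous dTE.
have cPhi : continuous Phi := is_derive_continuous dPhi.
have ct1 : continuous (fun x => (t x)^-1).
  have -> : (fun x => (t x)^-1) = (fun x => t x `^ (-1)).
    by apply/funext => x; rewrite powRN powRr1// ltW.
  exact: cta.
have cdT : continuous dT.
  apply: continuous_add; apply: continuous_mul => //.
  apply: continuous_mul; first exact: (@continuous_scale _ (p - 2)).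
  by apply: continuous_mul => //; exact: continuous_mul.
have dcut := is_derive_cut r; have dcut' := is_derive_cut' r.
have ccut := is_derive_continuous dcut; have ccut' := is_derive_continuous dcut'.
have ccut'' := @continuous_cut'' _ r.
(* Since Phi' = T u, the terms [cut' * T * u] cancel in F', and y' remains only in the nonnegative
   term [cut * dT * u]. *)
pose F x := cut r x * (T x * u x) - cut' r x * Phi x.
have acF a b : abs_continuous a b F.
  have -> : F = (fun x => cut r x * (T x * u x)) \+ (fun x => -1 * (cut' r x * Phi x)).
    by apply/funext => x; rewrite /F /= mulN1r.
  apply: abs_continuousD.
    apply: abs_continuousM; first exact: C1_abs_continuous dcut ccut' a b.
    by apply: abs_continuousM => //; exact: C1_abs_continuous dTE cdT a b.
  apply: abs_continuousZ; apply: abs_continuousM.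
    exact: C1_abs_continuous dcut' ccut'' a b.
  apply: C1_abs_continuous dPhi _ a b; exact: continuous_mul.
have cutB (x : R) : `|x| = 2 * r -> cut r x = 0 /\ cut' r x = 0.
  move=> xr; have s0 : pospart (1 - (4 * r ^+ 2)^-1 * x ^+ 2) = 0.
    rewrite -(real_normK (num_real x)) xr /pospart.
    have -> : 1 - (4 * r ^+ 2)^-1 * (2 * r) ^+ 2 = 0 by field; rewrite gt_eqF.
    by rewrite maxxx.
  by rewrite /cut /cut' s0 !expr0n/= mulr0.
have F0 : F (2 * r) - F (- (2 * r)) = 0.
  have [a1 a2] := cutB (2 * r) (ger0_norm (mulr_ge0 (ler0n _ 2) (ltW r0))).
  have [|a3 a4] := cutB (- (2 * r)).
    by rewrite normrN ger0_norm// mulr_ge0// ltW.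
  by rewrite /F a1 a2 a3 a4; ring.
pose h1 x := 2^-1 * (`|q x| * (cut r x * `|y x| `^ p)).
(* The 9 counts multiples of t^p: 8 from [cut''_le] and 1 from [regabs_young]; [regabs_powR_le]
   turns t^p into 2^p (|y|^p + e^p). The factors 2^-1 come from [norm_powR_le_regabs]. *)
pose h2 x := `|f x| `^ p + 9 * 2 `^ p * `|y x| `^ p + e `^ p * (2^-1 * `|q x| + 9 * 2 `^ p).
have iaq : mu.-integrable `[(- (2 * r))%R, (2 * r)%R] (EFin \o (fun x => `|q x|)).
  exact: (integrable_norm iq).
have ih1 : mu.-integrable `[(- (2 * r))%R, (2 * r)%R] (EFin \o h1).
  exact: integrable_cut_energy r0 iq cy.
have ih2 : mu.-integrable `[(- (2 * r))%R, (2 * r)%R] (EFin \o h2).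
  apply: integrableRD => //.
    by apply: integrableRD => //; exact: integrableRZ.
  apply: integrableRZ => //; apply: integrableRD => //; first exact: integrableRZ.
  apply: continuous_integrable_segment => x; exact: cst_continuous.
rewrite -subr_le0 -F0 -RintegralB//.
apply: FTC_ge => //; first exact: integrableRB.
apply: (ae_mono3 q0 yf (AC1_ae_derivable acy)) => x qx0 yE du xr rx _.
have {}du : is_derive x 1 u (derive1n 2 y x) := du.
have dF : is_derive x 1 F
    (cut r x * (dT x * u x) + cut r x * (T x * derive1n 2 y x) - cut'' r x * Phi x).
  have D1 := is_derive1M (dcut x) (is_derive1M (dTE x) du).
  have D2 := is_derive1M (dcut' x) (dPhi x).
  apply: is_derive1_eqval (is_derive1B D1 D2) _; ring.
rewrite (is_derive1_derive1 dF).
have -> : derive1n 2 y x = q x * y x - f x by rewrite -yE; ring.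
(* This is the convexity: t^2 + (p - 2) y^2 = (p - 1) y^2 + e^2. *)
have dTu : 0 <= dT x * u x.
  have -> : dT x * u x = u x ^+ 2 * (t x `^ (p - 2) / t x ^+ 2) * (t x ^+ 2 + (p - 2) * y x ^+ 2).
    have E : t x `^ (p - 2) = t x * t x `^ (p - 2 - 1).
      rewrite -{2}(powRr1 (ltW (t0 x))) -powRD; last by rewrite (lt0r_neq0 (t0 x)) implybT.
      by congr (_ `^ _); ring.
    rewrite /dT E; move: (t x `^ (p - 2 - 1)) => w; field; by rewrite gt_eqF.
  have h3 : 0 <= t x ^+ 2 + (p - 2) * y x ^+ 2.
    have p1 : 0 <= (p - 1) * y x ^+ 2 by rewrite mulr_ge0 ?sqr_ge0// subr_ge0 ltW.
    by rewrite /t regabs_sqr//; have := sqr_ge0 e; lra.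
  exact: mulr_ge0 (mulr_ge0 (sqr_ge0 _) (divr_ge0 (powR_ge0 _ _) (sqr_ge0 _))) h3.
have k0 := cut_ge0 r x; have k1 := cut_le1 r0 x.
have A1 := norm_powR_le_regabs e0 (y x).
have A2 := regabs_young e0 (y x) (normr_ge0 (f x)).
have A3 := regabs_powR_le e0 (y x).
have A4 := cut''_le r0 x.
rewrite -/(t x) in A1 A2 A3; rewrite /h1 /h2 (ger0_norm qx0).
have tp0 : 0 <= t x `^ p := powR_ge0 _ _.
have B1 : - (8 * t x `^ p) <= - (cut'' r x * Phi x).
  rewrite lerN2 (le_trans (ler_norm _))// normrM /Phi.
  rewrite ler_pM//; last first.
    rewrite ger0_norm ?mulr_ge0 ?invr_ge0 ?(ltW p0)//.
    by rewrite ler_piMl// invf_le1// ltW.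
  rewrite (le_trans A4)// ler_pdivrMr ?exprn_gt0// ler_peMr// exprn_ege1//.
have B2 : - (t x `^ p + `|f x| `^ p) <= - (cut r x * (T x * f x)).
  rewrite lerN2 (le_trans (ler_norm _))// normrM (ger0_norm k0).
  apply: le_trans (_ : `|T x * f x| <= _); first by rewrite ler_piMl.
  by apply: le_trans A2; rewrite /T !normrM (ger0_norm (powR_ge0 _ _)).
have B3 : 2^-1 * (cut r x * `|y x| `^ p) - 2^-1 * e `^ p <= cut r x * (T x * y x).
  have -> : T x * y x = y x ^+ 2 * t x `^ (p - 2) by rewrite /T; ring.
  have ep0 : 0 <= e `^ p := powR_ge0 _ _.
  nra.
have B4 := ler_wpM2l qx0 B3.
have B5 : 0 <= cut r x * (dT x * u x) by rewrite mulr_ge0.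
lra.
Qed.

Lemma EFin_Rintegral (D : set R) (h : R -> R) : measurable D ->
  mu.-integrable D (EFin \o h) ->
  (\int[mu]_(x in D) h x)%:E = (\int[mu]_(x in D) (h x)%:E)%E.
Proof. by move=> mD ih; rewrite /Rintegral fineK// (integrable_fin_num _ ih). Qed.

(** The regularisation error is e^p times [A], which contains the integral of |q| over [[-2r, 2r]]
    and is finite for fixed r. Taking e^p = d / (A + 1) makes it at most d. *)
Lemma energy_cutoff q f y r : {ae mu, forall x, 0 <= q x} ->
  locally_integrable [set: R] q -> solution q f y -> in_Lp p f -> in_Lp p y -> 1 <= r ->
  \int[mu]_(x in `[(- (2 * r))%R, (2 * r)%R]) (2^-1 * (`|q x| * (cut r x * `|y x| `^ p))) <=
  \int[mu]_x (`|f x| `^ p) + 9 * 2 `^ p * \int[mu]_x (`|y x| `^ p).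
Proof.
move=> q0 lq sy /in_LpP-/(_ (lt0r_neq0 p0))[mf iF] /in_LpP-/(_ (lt0r_neq0 p0))[my iY] r1.
set D : set R := `[_, _]%classic; have mD : measurable D by exact: measurable_itv.
have iFD : mu.-integrable D (EFin \o (fun x => `|f x| `^ p)) by exact: integrableS iF.
have iYD : mu.-integrable D (EFin \o (fun x => `|y x| `^ p)) by exact: integrableS iY.
have iq : mu.-integrable D (EFin \o q) by exact: locally_integrable_segment.
have iaq : mu.-integrable D (EFin \o (fun x => `|q x|)) by exact: (integrable_norm iq).
have ic (c : R) : mu.-integrable D (EFin \o (cst c : R -> R)).
  by apply: continuous_integrable_segment => x; exact: cst_continuous.
have iA : mu.-integrable D (EFin \o (fun x => 2^-1 * `|q x| + cst (9 * 2 `^ p) x)).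
  by apply: integrableRD => //; exact: integrableRZ.
pose A := \int[mu]_(x in D) (2^-1 * `|q x| + cst (9 * 2 `^ p) x).
have A0 : 0 <= A.
  by apply: Rintegral_ge0 => x _; rewrite addr_ge0 ?mulr_ge0 ?powR_ge0.
apply/ler_addgt0Pr => d d0.
pose e := (d / (A + 1)) `^ p^-1.
have dA : 0 < d / (A + 1) by rewrite divr_gt0// ltr_wpDl.
have e0 : 0 < e by rewrite powR_gt0.
have ep : e `^ p = d / (A + 1) by rewrite -powRrM mulVf ?gt_eqF// powRr1// ltW.
apply: le_trans (energy_local q0 sy r1 e0 iq iFD iYD) _.
rewrite RintegralD//; last 2 first.
- by apply: integrableRD => //; exact: integrableRZ.
- exact: integrableRZ.
rewrite RintegralD//; last exact: integrableRZ.
rewrite !RintegralZl// -/A ep.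
rewrite !lerD//.
- by apply: Rintegral_segment_le => // x; exact: powR_ge0.
- rewrite ler_wpM2l ?mulr_ge0 ?powR_ge0//.
  by apply: Rintegral_segment_le => // x; exact: powR_ge0.
- by rewrite mulrAC ler_pdivrMr ?ltr_wpDl// ler_wpM2l ?(ltW d0)// lerDl.
Qed.

(** The factor 128/27 undoes the 2^-1 of the local estimate and the lower bound 27/64 of the cutoff
    on [[-r, r]]; the right-hand side of [energy_cutoff] does not depend on r, so r may grow. *)
Lemma energy q f y : {ae mu, forall x, 0 <= q x} ->
  locally_integrable [set: R] q -> solution q f y -> in_Lp p f -> in_Lp p y ->
  (pint p (fun x => q x `^ p^-1 * y x)%R <=
    (128 / 27 * (9 * 2 `^ p))%:E * (pint p f + pint p y))%E.
Proof.
move=> q0 lq sy Lf Ly.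
have /in_LpP-/(_ (lt0r_neq0 p0))[mf iF] := Lf; have /in_LpP-/(_ (lt0r_neq0 p0))[my iY] := Ly.
have [mq _ _] := lq.
pose If := \int[mu]_x (`|f x| `^ p); pose Iy := \int[mu]_x (`|y x| `^ p).
have If0 : 0 <= If by apply: Rintegral_ge0 => x _; exact: powR_ge0.
have IfE : pint p f = If%:E by rewrite EFin_Rintegral.
have IyE : pint p y = Iy%:E by rewrite EFin_Rintegral.
have mQ : measurable_fun setT (fun x => `|q x| * `|y x| `^ p).
  apply: measurable_funM; first exact: measurableT_comp.
  exact: measurable_powR_norm.
apply: (@le_trans _ _ (\int[mu]_x (`|q x| * `|y x| `^ p)%:E)%E).
  apply: ge0_integral_le_ae => [x|x|].
  - by rewrite lee_fin powR_ge0.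
  - by rewrite lee_fin mulr_ge0 ?powR_ge0.
  - apply: (ae_mono q0) => x qx; congr EFin.
    rewrite normrM (ger0_norm (powR_ge0 _ _)) powRM ?powR_ge0// -powRrM mulVf ?gt_eqF//.
    by rewrite (powRr1 qx) (ger0_norm qx).
apply: (@le_trans _ _ (128 / 27 * (If + 9 * 2 `^ p * Iy))%:E); last first.
  rewrite IfE IyE -EFinD -EFinM lee_fin -[leRHS]mulrA ler_wpM2l//.
  have p2 : 2 `^ 0 <= (2 : R) `^ p by rewrite ler_powR ?ler1n// ltW.
  rewrite powRr0 in p2.
  by rewrite mulrDr lerD2r ler_peMl//; nra.
apply: ge0_integral_exhaust => // n.
set r : R := n.+1%:R; have r1 : 1 <= r by rewrite ler1n.
have r0 : 0 < r := lt_le_trans ltr01 r1.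
pose h1 x := 2^-1 * (`|q x| * (cut r x * `|y x| `^ p)).
have h10 x : 0 <= h1 x.
  rewrite mulr_ge0// mulr_ge0// mulr_ge0 ?powR_ge0//; exact: cut_ge0.
have mh1 : measurable_fun setT h1.
  apply: measurable_funM => //; apply: measurable_funM; first exact: measurableT_comp.
  apply: measurable_funM; last exact: measurable_powR_norm.
  by apply: continuous_measurable_fun; exact: is_derive_continuous (is_derive_cut r).
have E := energy_cutoff q0 lq sy Lf Ly r1.
have ih1 : mu.-integrable `[(- (2 * r))%R, (2 * r)%R] (EFin \o h1).
  exact: integrable_cut_energy r0 (locally_integrable_segment _ _ lq) (AC1_continuous sy.1).
apply: (@le_trans _ _ (\int[mu]_(x in `[(- r)%R, r]) ((128 / 27)%:E * (h1 x)%:E))%E).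
  apply: ge0_le_integral => //.
  - by apply: measurable_funTS; exact/measurable_EFinP.
  - by apply: measurable_funTS; apply/measurable_EFinP; exact: measurable_funM.
  - move=> x; rewrite /= in_itv/= => xr; rewrite -EFinM lee_fin /h1.
    have := cut_in r0 xr; have qy : 0 <= `|q x| * `|y x| `^ p by rewrite mulr_ge0 ?powR_ge0.
    move: (cut r x) => k; nra.
rewrite ge0_integralZl//; last 2 first.
- by apply: measurable_funTS; exact/measurable_EFinP.
- by move=> x _; rewrite lee_fin.
rewrite [leRHS]EFinM lee_wpmul2l ?lee_fin//.
apply: (@le_trans _ _ (\int[mu]_(x in `[(- (2 * r))%R, (2 * r)%R]) (h1 x)%:E)%E).
  apply: ge0_subset_integral => //.
  - by apply: measurable_funTS; exact/measurable_EFinP.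
  - by move=> x _; rewrite lee_fin.
  - by move=> x; rewrite /= !in_itv/= => /andP[a1 a2]; apply/andP; split; lra.
by rewrite -EFin_Rintegral// lee_fin.
Qed.

End Energy.

(** * The spaces S and W *)

Lemma eq_of_sub0 (T : Type) (V : zmodType) (f g : T -> V) :
  (fun x => f x - g x) = cst 0 -> f = g.
Proof. by move=> fg; apply/funext => x; apply/subr0_eq; exact: (congr1 (@^~ x) fg). Qed.

Section Spaces.
Context {R : realType}.
Notation mu := (@lebesgue_measure R).
Variables (p : R) (q : R -> R).
Hypothesis hp : 1 < p.
Hypothesis hq : locally_integrable [set: R] q.
Hypothesis hq0 : {ae mu, forall x, 0 <= q x}.
Hypothesis hsolv : correctly_solvable p q.
Implicit Types (f y z : R -> R).

Let p0 : 0 < p. Proof. exact: lt_trans hp. Qed.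
Let mq : measurable_fun setT q. Proof. by have [] := hq. Qed.

Let mrq : measurable_fun setT (fun x => q x `^ p^-1).
Proof. exact: (@measurableT_comp _ _ _ _ _ _ (@powR R ^~ p^-1)). Qed.

Lemma energy_norm : exists2 K : R, 0 <= K & forall f y, in_Lp p f -> solution q f y ->
  in_Lp p y -> (Lp_norm p (fun x => (q x `^ p^-1 * y x)%R) <= K%:E * Lp_norm p f)%E.
Proof.
have [_ [c c0 Hc]] := hsolv.
pose K := 128 / 27 * (9 * 2 `^ p) * (1 + c `^ p).
have K0 : 0 <= K by rewrite mulr_ge0// addr_ge0// powR_ge0.
exists (K `^ p^-1) => [|f y Lf sy Ly]; first exact: powR_ge0.
apply: norm_le_pint => //; apply: le_trans (energy hp hq0 hq sy Lf Ly) _.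
rewrite /K [in leRHS]EFinM -muleA lee_wpmul2l ?lee_fin//.
rewrite EFinD ge0_muleDl ?lee_fin ?powR_ge0// mul1e leeD2l//.
by apply: pint_le_norm (Hc _ _ Lf sy Ly) => //; exact: ltW.
Qed.

Lemma solution_second_derivative f y : solution q f y ->
  {ae mu, forall x, derive1n 2 y x - q x * y x = - f x}.
Proof. by move=> [_ E]; apply: (ae_mono E) => x <-; rewrite opprD opprK. Qed.

Lemma Lp_norm_residual f y : solution q f y ->
  Lp_norm p (fun x => derive1n 2 y x - q x * y x) = Lp_norm p f.
Proof.
by move=> sy; rewrite (Lp_norm_ae p (solution_second_derivative sy)); exact: Lp_normN.
Qed.

Lemma AC1_measurable_fun y : AC1_loc y -> measurable_fun setT y.
Proof. by move=> acy; apply: continuous_measurable_fun; exact: AC1_continuous. Qed.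

(** Membership in L_p asks for Borel measurability, so the right-hand side is formed with a Borel
    version of y''. *)
Lemma solution_in_Lp y : AC1_loc y ->
  (Lp_norm p (fun x => (derive1n 2 y x - q x * y x)%R) < +oo)%E ->
  exists2 f, in_Lp p f & solution q f y.
Proof.
move=> acy; have [g mg yg] := AC1_measurable acy.
have my := AC1_measurable_fun acy.
pose f x := q x * y x - g x; have mf : measurable_fun setT f.
  by apply: measurable_funB => //; exact: measurable_funM.
have sy : solution q f y.
  by split=> //; apply: (ae_mono yg) => x ->; rewrite addrC.
by rewrite (Lp_norm_residual sy) => fp; exists f => //; apply/in_LpE.
Qed.

Lemma Lp_norm_residual_le y : AC1_loc y ->
  (Lp_norm p (fun x => (derive1n 2 y x - q x * y x)%R) <= W_norm p q y)%E.
Proof.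
move=> acy; have [g mg yg] := AC1_measurable acy.
have my := AC1_measurable_fun acy.
rewrite /W_norm (Lp_norm_ae p yg).
have yg' : {ae mu, forall x, derive1n 2 y x - q x * y x = (g \+ (\- (fun x => q x * y x))) x}.
  by apply: (ae_mono yg) => x ->.
rewrite (Lp_norm_ae p yg') -(Lp_normN p (fun x => q x * y x)).
have mqy : measurable_fun setT (fun x => q x * y x) by exact: measurable_funM.
apply: Lp_normD => //; first exact: ltW.
exact: measurableT_comp.
Qed.

Lemma homogeneous_sub f y1 y2 : solution q f y1 -> solution q f y2 ->
  homogeneous q (fun x => y1 x - y2 x).
Proof.
move=> [ac1 E1] [ac2 E2]; have [ac E] := AC1_B ac1 ac2; split=> //.
apply: (ae_mono3 E1 E2 E) => x e1 e2 ->.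
have -> : derive1n 2 y1 x = q x * y1 x - f x by rewrite -e1; ring.
have -> : derive1n 2 y2 x = q x * y2 x - f x by rewrite -e2; ring.
by ring.
Qed.

Lemma energy_homogeneous z : homogeneous q z ->
  in_Lp p (fun x => q x `^ p^-1 * z x) -> z = cst 0.
Proof.
move=> hz /in_LpP-/(_ (lt0r_neq0 p0))[_ iz].
have iQ : mu.-integrable setT (EFin \o (fun x => `|q x| * `|z x| `^ p)).
  have [acz _] := hz; have mz := AC1_measurable_fun acz.
  apply: integrable_ae_eq iz => //.
    apply/measurable_EFinP; apply: measurable_funM; first exact: measurableT_comp.
    exact: measurable_powR_norm.
  apply: (ae_mono hq0) => x qx _ /=; congr EFin.
  rewrite normrM (ger0_norm (powR_ge0 _ _)) powRM ?powR_ge0// -powRrM mulVf ?gt_eqF//.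
  by rewrite (powRr1 qx) (ger0_norm qx).
have [M HM] := homogeneous_bounded hp hq0 hz iQ.
apply: (@homogeneous_growth _ _ _ hp hq0 _ `|M| hz _ hsolv) => r x r1 _.
apply: le_trans (HM x) _; apply: le_trans (ler_norm M) _.
have r1p : r `^ 0 <= r `^ (1 - p^-1) by rewrite ler_powR// subr_ge0 invf_le1// ltW.
by rewrite powRr0 in r1p; rewrite ler_peMr.
Qed.

Lemma second_derivative_homogeneous z : homogeneous q z ->
  in_Lp p (fun x => q x * z x) -> z = cst 0.
Proof.
move=> hz /in_LpP-/(_ (lt0r_neq0 p0))[_ iz].
have [C HC] := homogeneous_second_derivative_growth hp hq0 hz iz.
exact: (homogeneous_growth hp hq0 hz HC hsolv).
Qed.

End Spaces.

Unset Implicit Arguments.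
Set Strict Implicit.
Set Printing Implicit Defensive.

Theorem theorem1p6 (R : realType) (p : R) (q : R -> R)
    (hp : 1 < p)
    (hq : locally_integrable [set: R] q)
    (hq0 : {ae @lebesgue_measure R, forall x, 0 <= q x})
    (hsolv : correctly_solvable p q) :
  isomorphic (S_space p q) (S_norm p q) (W_space p q) (W_norm p q)
  <-> separable p q.
Proof.
have p0 : 0 < p := lt_trans ltr01 hp.
have [K K0 HK] := energy_norm hp hq hq0 hsolv.
have mq : measurable_fun setT q by have [] := hq.
have mrq : measurable_fun setT (fun x => q x `^ p^-1).
  exact: (@measurableT_comp _ _ _ _ _ _ (@powR R ^~ p^-1)).
have S_le f y : in_Lp p f -> solution q f y -> in_Lp p y ->
    (S_norm p q y <= (1 + K)%:E * Lp_norm p f)%E.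
  move=> Lf sy Ly; rewrite /S_norm (Lp_norm_residual p sy).
  rewrite EFinD ge0_muleDl ?lee_fin// mul1e leeD2l//.
  exact: HK.
split=> [[SW [c1 [c2 [_ c20 Hc]]]]|[_ [c c0 Hc]]].
  (* By [S_le] the L_p solution lies in S with norm at most (1 + K) times that of f; c2 converts
     this into a bound on the norm of W. *)
  split=> //; exists (c2 * (1 + K)); first by rewrite mulr_gt0// ltr_wpDr.
  move=> f y Lf sy Ly; have Sy := S_le _ _ Lf sy Ly.
  have /in_LpE[_ ff] := Lf.
  have yS : S_space p q y.
    split; first exact: sy.1.
    by apply: le_lt_trans Sy _; rewrite lte_mul_pinfty// lee_fin addr_ge0.
  apply: le_trans (Hc y yS).2 _.
  by rewrite EFinM -muleA lee_wpmul2l// lee_fin ltW.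
have HS y : S_space p q y -> exists f, [/\ in_Lp p f, solution q f y & in_Lp p y].
  move=> [acy]; rewrite /S_norm => Sy.
  have Sy1 : (Lp_norm p (fun x => (derive1n 2 y x - q x * y x)%R) < +oo)%E.
    by apply: le_lt_trans Sy; rewrite leeDl// Lp_norm_ge0.
  have Sy2 : (Lp_norm p (fun x => (q x `^ p^-1 * y x)%R) < +oo)%E.
    by apply: le_lt_trans Sy; rewrite leeDr// Lp_norm_ge0.
  have [f Lf sy] := solution_in_Lp hq acy Sy1.
  (* [y0] is the L_p solution with the same right-hand side. The energy estimate controls q^(1/p)
     y0, so the difference y - y0 satisfies the hypotheses of [energy_homogeneous]. *)
  have [y0 [[sy0 Ly0] _]] := hsolv.1 f Lf; exists f; split=> //.
  have my := AC1_measurable_fun acy; have my0 := AC1_measurable_fun sy0.1.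
  have L1 : in_Lp p (fun x => q x `^ p^-1 * y x).
    by apply/in_LpE; split => //; exact: measurable_funM.
  have L0 : in_Lp p (fun x => q x `^ p^-1 * y0 x).
    apply/in_LpE; split; first exact: measurable_funM.
    apply: le_lt_trans (HK _ _ Lf sy0 Ly0) _.
    by have /in_LpE[_ ff] := Lf; rewrite lte_mul_pinfty.
  suff -> : y = y0 by [].
  apply: (eq_of_sub0 (energy_homogeneous hp hq hq0 hsolv (homogeneous_sub sy sy0) _)).
  have := in_LpB (ltW hp) L1 L0.
  by congr in_Lp; apply/funext => x /=; rewrite mulrBr.
have HW y : W_space p q y -> exists f, [/\ in_Lp p f, solution q f y & in_Lp p y].
  move=> [acy Wy].
  have [f Lf sy] := solution_in_Lp hq acy (le_lt_trans (Lp_norm_residual_le hp hq acy) Wy).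
  have [y0 [[sy0 Ly0] _]] := hsolv.1 f Lf; exists f; split=> //.
  have my := AC1_measurable_fun acy; have my0 := AC1_measurable_fun sy0.1.
  have L1 : in_Lp p (fun x => q x * y x).
    apply/in_LpE; split; first exact: measurable_funM.
    by apply: le_lt_trans Wy; rewrite leeDr// Lp_norm_ge0.
  (* Separability is what puts q y0 in L_p. *)
  have L0 : in_Lp p (fun x => q x * y0 x).
    apply/in_LpE; split; first exact: measurable_funM.
    apply: (@le_lt_trans _ _ (c%:E * Lp_norm p f)%E); last first.
      by have /in_LpE[_ ff] := Lf; rewrite lte_mul_pinfty// lee_fin ltW.
    by apply: le_trans (Hc _ _ Lf sy0 Ly0); rewrite leeDr// Lp_norm_ge0.
  suff -> : y = y0 by [].
  apply: (eq_of_sub0 (second_derivative_homogeneous hp hq0 hsolv (homogeneous_sub sy sy0) _)).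
  have := in_LpB (ltW hp) L1 L0.
  by congr in_Lp; apply/funext => x /=; rewrite mulrBr.
have f_le_S f y : solution q f y -> (Lp_norm p f <= S_norm p q y)%E.
  by move=> sy; rewrite -(Lp_norm_residual p sy) /S_norm leeDl// Lp_norm_ge0.
have f_le_W f y : solution q f y -> (Lp_norm p f <= W_norm p q y)%E.
  by move=> sy; rewrite -(Lp_norm_residual p sy); exact: Lp_norm_residual_le sy.1.
split.
  apply/seteqP; split => y yX; split; try exact: yX.1.
    have [f [Lf sy Ly]] := HS _ yX; apply: le_lt_trans (Hc _ _ Lf sy Ly) _.
    by have /in_LpE[_ ff] := Lf; rewrite lte_mul_pinfty// lee_fin ltW.
  have [f [Lf sy Ly]] := HW _ yX; apply: le_lt_trans (S_le _ _ Lf sy Ly) _.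
  by have /in_LpE[_ ff] := Lf; rewrite lte_mul_pinfty// lee_fin addr_ge0.
have K1 : 0 < 1 + K by rewrite ltr_wpDr.
(* The norm of f lies below both norms of y, while the S norm is at most 1 + K times it and the W
   norm at most c times it. *)
exists (1 + K)^-1, c; split=> //; first by rewrite invr_gt0.
move=> y yS; have [f [Lf sy Ly]] := HS _ yS; split.
  rewrite lee_pdivrMl//; apply: le_trans (S_le _ _ Lf sy Ly) _.
  by rewrite lee_wpmul2l ?lee_fin ?(ltW K1)//; exact: f_le_W.
apply: le_trans (Hc _ _ Lf sy Ly) _.
by rewrite lee_wpmul2l ?lee_fin ?(ltW c0)//; exact: f_le_S.
Qed.
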